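(* Let $\omega$ be a quaternionic $CR$ structure on an open set $U$ of a $(4n+3)$-dimensional manifold ($n\ge1$), and let $\omega'=\lambda\cdot\omega\cdot\bar\lambda$ for a smooth function $\lambda:U\to\mathbb H^*$. Then the curvature tensor $T'$ of $\omega'$ satisfies $T'^i_{jk\ell}=T^i_{jk\ell}$. In particular, $T=(T^i_{jk\ell})$ is an invariant tensor under the pseudo-conformal quaternionic $CR$ structure.
   Context: Conventions: $(\alpha,\beta,\gamma)$ is any cyclic permutation of $(1,2,3)$; $d\eta(X,Y)=\frac12(X\eta(Y)-Y\eta(X)-\eta([X,Y]))$ and $(\eta\wedge\zeta)(X,Y)=\frac12(\eta(X)\zeta(Y)-\eta(Y)\zeta(X))$ for $1$-forms; $\operatorname{Null}$ of a form is its kernel. Quaternionic $CR$ structure on $U$: an $\operatorname{Im}\mathbb H$-valued $1$-form $\omega=\omega_1\boldsymbol i+\omega_2\boldsymbol j+\omega_3\boldsymbol k$ such that, with $\mathcal D=\bigcap_\alpha\operatorname{Null}\omega_\alpha$ (rank $4n$) and $\sigma_\alpha=d\omega_\alpha|_{\mathcal D}$: $\mathcal D$ and $[\mathcal D,\mathcal D]$ span $TU$; each $\sigma_\alpha$ is nondegenerate; the endomorphisms $J_\gamma$ of $\mathcal D$ given by $\sigma_\beta(J_\gamma X,Y)=\sigma_\alpha(X,Y)$ satisfy $J_\gamma^2=-1$, $J_\alpha J_\beta=J_\gamma=-J_\beta J_\alpha$; and the $2$-forms $\rho_\alpha=d\omega_\alpha+2\omega_\beta\wedge\omega_\gamma$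 have a common null distribution $V$, of rank $3$ and complementary to $\mathcal D$. $g^{\mathcal D}(X,Y)=\sigma_\alpha(J_\alpha X,Y)$ (independent of $\alpha$). Tensor $T$ of $\omega$: choose a $g^{\mathcal D}$-orthonormal frame $e_1,\dots,e_{4n}$ of $\mathcal D$, $g_{ij}=g^{\mathcal D}(e_i,e_j)$, $\theta^i(e_j)=\delta^i_j$, $\theta^i|_V=0$, $\theta_j=g_{jk}\theta^k$, $\mathbf J^a_{ij}=g^{\mathcal D}(J_ae_i,e_j)$, $(\mathbf J^a)^i_j=g^{ik}\mathbf J^a_{kj}$. Let $\tilde g=\sum_a\omega_a\cdot\omega_a+g_{ij}\theta^i\cdot\theta^j$ with Levi-Civita connection $\nabla$, $\varphi^i_j=\theta^i(\nabla e_j)$, $\tau^i_a=(\mathbf J^a)^i_j\theta^j$, so $d\theta^i=\theta^j\wedge\varphi^i_j+\sum_a\omega_a\wedge\tau^i_a$. $T^i_{jk\ell}$ (skew in $k,\ell$) is defined modulo $\omega_1,\omega_2,\omega_3$ by $$\tfrac12T^i_{jk\ell}\theta^k\wedge\theta^\ell\equiv d\varphi^i_j-\varphi^\sigma_j\wedge\varphi^i_\sigma+\sum_a\mathbf J^a_{jk}\theta^k\wedge\tau^i_a-\theta^i\wedge\theta_j.$$ Tensor $T'$ of $\omega'=\lambda\omega\bar\lambda$: write $\lambda=u\cdot a$, $u>0$, $a\in\mathrm{Sp}(1)$, and let $A\in\mathrm{SO}(3)$ be given by $a\,{}^t(\boldsymbol i,\boldsymbol j,\boldsymbol k)\,\bar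 a=A\,{}^t(\boldsymbol i,\boldsymbol j,\boldsymbol k)$, so $(\omega'_1,\omega'_2,\omega'_3)=u^2(\omega_1,\omega_2,\omega_3)A$. The quaternionic structure of $\omega'$ on $\mathcal D$ is ${}^t(J'_1,J'_2,J'_3)={}^tA\;{}^t(J_1,J_2,J_3)$, with matrices $(\mathbf J'^1_{ij},\mathbf J'^2_{ij},\mathbf J'^3_{ij})=(\mathbf J^1_{ij},\mathbf J^2_{ij},\mathbf J^3_{ij})A$, and $1$-forms $\nu'^i_a$ are defined by ${}^t(\nu'^i_1,\nu'^i_2,\nu'^i_3)=u^{-2}\,{}^tA\;{}^t(\tau^i_1,\tau^i_2,\tau^i_3)$, so that $d\theta^i=\theta^j\wedge\varphi^i_j+\sum_a\omega'_a\wedge\nu'^i_a$. $T'^i_{jk\ell}$ (skew in $k,\ell$) is defined modulo $\omega_1,\omega_2,\omega_3$ by $$\tfrac12T'^i_{jk\ell}\theta^k\wedge\theta^\ell\equiv d\varphi^i_j-\varphi^\sigma_j\wedge\varphi^i_\sigma+\sum_au^2\,\mathbf J'^a_{jk}\theta^k\wedge\nu'^i_a-\theta^i\wedge\theta_j.$$ A pseudo-conformal quaternionic $CR$ structure is given by local quaternionic $CR$ structures related by $\omega'=\lambda\omega\bar\lambda$. *)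

(* Defs.v *)
From mathcomp Require Import all_boot all_order all_algebra.
From mathcomp Require Import boolp classical_sets functions cardinality reals.
From mathcomp Require Import topology normedtype derive.

Set Implicit Arguments.
Unset Strict Implicit.
Unset Printing Implicit Defensive.

Import Order.TTheory GRing.Theory Num.Theory.
Import numFieldNormedType.Exports.

Local Open Scope classical_set_scope.
Local Open Scope ring_scope.

Section EuclideanSmoothness.
Variables (R : realType) (m : nat).

Fixpoint class_C (k : nat) (O : set 'rV[R]_m) (f : 'rV[R]_m -> R) : Prop :=
  (forall x, O x -> {for x, continuous f}) /\
  (if k is k'.+1 then
     forall i : 'I_m,
       (forall x, O x -> derivable f x (delta_mx 0 i)) /\
       class_C k' O (fun x => 'D_(delta_mx 0 i) f x)
   else True).

Definition class_Coo O f := forall k, class_C k O f.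

End EuclideanSmoothness.

Section Manifold.
Variables (R : realType) (m : nat).

(* The local inverse [chart_inv] is only meaningful on the image of
   [chart_dom]. *)
Record chart (M : topologicalType) := Chart {
  chart_dom : set M;
  chart_map : M -> 'rV[R]_m;
  chart_inv : 'rV[R]_m -> M }.

Definition chart_img (M : topologicalType) (c : chart M) (W : set M) :
    set 'rV[R]_m :=
  chart_map c @` (chart_dom c `&` W).

Record is_chart (M : topologicalType) (c : chart M) : Prop := IsChart {
  chart_dom_open : open (chart_dom c);
  chart_img_open : open (chart_img c setT);
  chart_mapK : forall p, chart_dom c p -> chart_inv c (chart_map c p) = p;
  chart_map_cont : forall p, chart_dom c p -> {for p, continuous (chart_map c)};
  chart_inv_cont :
    forall x, chart_img c setT x -> {for x, continuous (chart_inv c)} }.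

Definition smooth_transition (M : topologicalType) (c d : chart M) : Prop :=
  forall i : 'I_m,
    class_Coo (chart_img c (chart_dom d))
              (fun x => chart_map d (chart_inv c x) 0 i).

Record manifold := Manifold {
  carrier :> topologicalType;
  manifold_hausdorff : hausdorff_space carrier;
  manifold_second_countable : @second_countable carrier;
  atlas : set (chart carrier);
  atlas_chart : forall c, atlas c -> is_chart c;
  atlas_cover : forall p, exists2 c, atlas c & chart_dom c p;
  atlas_compat : forall c d, atlas c -> atlas d -> smooth_transition c d }.

End Manifold.

Section Calculus.
Variables (R : realType) (m : nat) (M : manifold R m).

Definition smooth_on (W : set M) (f : M -> R) : Prop :=
  forall c, @atlas _ _ M c ->
    class_Coo (chart_img c W) (fun x => f (chart_inv c x)).

Definition smooth_at (p : M) (f : M -> R) : Prop :=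
  exists W : set M, [/\ open W, W p & smooth_on W f].

(* A tangent vector at p is a derivation at p of the functions smooth near p.
   It acts on total functions M -> R; the value 0 is imposed on functions that
   are not smooth near p, so that two tangent vectors are equal as operators
   as soon as they agree on the functions smooth near p.  Dependence on the
   germ only follows from the Leibniz rule, because the indicator function of
   the complement of a neighbourhood of p is smooth near p. *)
Definition vec := (M -> R) -> R.

Record tangent (p : M) (v : vec) : Prop := Tangent {
  tangent_linear : forall (a : R) f g, smooth_at p f -> smooth_at p g ->
    v (fun q => a * f q + g q) = a * v f + v g;
  tangent_leibniz : forall f g, smooth_at p f -> smooth_at p g ->
    v (fun q => f q * g q) = v f * g p + f p * v g;
  tangent_junk : forall f, ~ smooth_at p f -> v f = 0 }.

Definition vadd (v w : vec) : vec := fun f => v f + w f.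
Definition vscale (a : R) (v : vec) : vec := fun f => a * v f.
Definition vcomb (k : nat) (c : 'I_k -> R) (e : 'I_k -> vec) : vec :=
  fun f => \sum_(i < k) c i * e i f.

Definition field := M -> vec.

Record vfield (W : set M) (X : field) : Prop := Vfield {
  vfield_tangent : forall p, W p -> tangent p (X p);
  vfield_smooth : forall O f, open O -> O `<=` W -> smooth_on O f ->
    smooth_on O (fun p => X p f) }.

Definition local_vfield (p : M) (X : field) : Prop :=
  exists W : set M, [/\ open W, W p & vfield W X].

Definition bracket (X Y : field) : field := fun p f =>
  if `[< smooth_at p f >]
  then X p (fun q => Y q f) - Y p (fun q => X q f) else 0.

(* A 1-form is given pointwise, and only its values on tangent vectors matter;
   a 2-form is given by its values on smooth vector fields. *)
Definition form1 := M -> vec -> R.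
Definition form2 := field -> field -> M -> R.

Record smooth_form (W : set M) (eta : form1) : Prop := SmoothForm {
  form_linear : forall p (a : R) v w, W p -> tangent p v -> tangent p w ->
    eta p (vadd (vscale a v) w) = a * eta p v + eta p w;
  form_smooth : forall O X, open O -> O `<=` W -> vfield O X ->
    smooth_on O (fun p => eta p (X p)) }.

Definition ext_d (eta : form1) : form2 := fun X Y p =>
  2^-1 * (X p (fun q => eta q (Y q)) - Y p (fun q => eta q (X q))
          - eta p (bracket X Y p)).

Definition wedge (eta zeta : form1) : form2 := fun X Y p =>
  2^-1 * (eta p (X p) * zeta p (Y p) - eta p (Y p) * zeta p (X p)).

Definition null_form2 (s : form2) (p : M) : set vec := [set v |
  exists X, [/\ local_vfield p X, X p = v &
    forall Y, local_vfield p Y -> s X Y p = 0]].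

Definition has_rank (k : nat) (S : set vec) : Prop :=
  exists e : 'I_k -> vec, (forall i, S (e i)) /\
    (forall v, S v -> exists! c : 'I_k -> R, v = vcomb c e).

(* [nabla p v Y] is the derivative at p, in the direction v, of a vector field
   Y defined near p. *)
Definition connection := M -> vec -> field -> vec.

Record Levi_Civita (W : set M) (g : M -> vec -> vec -> R)
    (nabla : connection) : Prop := LeviCivita {
  LC_tangent : forall p v Y, W p -> tangent p v -> local_vfield p Y ->
    tangent p (nabla p v Y);
  LC_smooth : forall O X Y, open O -> O `<=` W -> vfield O X -> vfield O Y ->
    vfield O (fun p => nabla p (X p) Y);
  LC_linear : forall p (a : R) v w Y, W p -> tangent p v -> tangent p w ->
    local_vfield p Y ->
    nabla p (vadd (vscale a v) w) Y
    = vadd (vscale a (nabla p v Y)) (nabla p w Y);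
  LC_additive : forall p v Y Z, W p -> tangent p v ->
    local_vfield p Y -> local_vfield p Z ->
    nabla p v (fun q => vadd (Y q) (Z q))
    = vadd (nabla p v Y) (nabla p v Z);
  LC_leibniz : forall p v h Y, W p -> tangent p v ->
    smooth_at p h -> local_vfield p Y ->
    nabla p v (fun q => vscale (h q) (Y q))
    = vadd (vscale (v h) (Y p)) (vscale (h p) (nabla p v Y));
  LC_metric : forall p v Y Z, W p -> tangent p v ->
    local_vfield p Y -> local_vfield p Z ->
    v (fun q => g q (Y q) (Z q))
    = g p (nabla p v Y) (Z p) + g p (Y p) (nabla p v Z);
  LC_torsion : forall p X Y, W p -> local_vfield p X -> local_vfield p Y ->
    forall f, nabla p (X p) Y f - nabla p (Y p) X f = bracket X Y p f }.

End Calculus.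

Section Quaternions.
Variable R : realType.

Record quat := Quat { q0 : R; q1 : R; q2 : R; q3 : R }.

Definition qmul (x y : quat) : quat := Quat
  (q0 x * q0 y - q1 x * q1 y - q2 x * q2 y - q3 x * q3 y)
  (q0 x * q1 y + q1 x * q0 y + q2 x * q3 y - q3 x * q2 y)
  (q0 x * q2 y - q1 x * q3 y + q2 x * q0 y + q3 x * q1 y)
  (q0 x * q3 y + q1 x * q2 y - q2 x * q1 y + q3 x * q0 y).

Definition qconj (x : quat) : quat := Quat (q0 x) (- q1 x) (- q2 x) (- q3 x).

Definition qnorm (x : quat) : R :=
  Num.sqrt (q0 x ^+ 2 + q1 x ^+ 2 + q2 x ^+ 2 + q3 x ^+ 2).

Definition qscale (r : R) (x : quat) : quat :=
  Quat (r * q0 x) (r * q1 x) (r * q2 x) (r * q3 x).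

Definition qzero : quat := Quat 0 0 0 0.

(* Im H and R^3, with the basis i, j, k indexed by 0, 1, 2. *)
Definition qim (x : 'I_3 -> R) : quat := Quat 0 (x 0) (x 1) (x 2).
Definition qcoord (x : quat) (c : 'I_3) : R :=
  if c == 0 then q1 x else if c == 1 then q2 x else q3 x.
Definition qbasis (r : 'I_3) : quat := qim (fun s => (s == r)%:R).

(* For lambda = u a with u > 0 and a in Sp(1). *)
Definition qmod (lam : quat) : R := qnorm lam.
Definition qunit (lam : quat) : quat := qscale (qnorm lam)^-1 lam.

(* The matrix A with  a (i,j,k)^T conj(a) = A (i,j,k)^T:  row r consists of the
   coordinates of a e_r conj(a). *)
Definition qrot (lam : quat) : 'M[R]_3 :=
  \matrix_(r, c) qcoord (qmul (qmul (qunit lam) (qbasis r)) (qconj (qunit lam))) c.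

End Quaternions.

(* The indices 1, 2, 3 are encoded by 'I_3 with its addition modulo 3, so that
   the cyclic permutations are the triples (a, a + 1, a + 2). *)
Section QuaternionicCR.
Variables (R : realType) (n : nat).
Local Notation manifold := (manifold R (4 * n + 3)).
Variable M : manifold.

Local Notation vec := (vec M).
Local Notation field := (field M).
Local Notation form1 := (form1 M).
Local Notation form2 := (form2 M).

Definition apply_endo (K : M -> vec -> vec) (X : field) : field :=
  fun p => K p (X p).

Section Structure.
Variables (omega : 'I_3 -> form1) (J : 'I_3 -> M -> vec -> vec).

Definition distD (p : M) : set vec :=
  [set v | tangent p v /\ forall a, omega a p v = 0].

Definition sectionD (W : set M) (X : field) : Prop :=
  vfield W X /\ forall p, W p -> distD p (X p).

Definition local_sectionD (p : M) (X : field) : Prop :=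
  exists W : set M, [/\ open W, W p & sectionD W X].

Definition rho (a : 'I_3) : form2 := fun X Y p =>
  ext_d (omega a) X Y p + 2 * wedge (omega (a + 1)) (omega (a + 2)) X Y p.

(* The common null distribution of the three forms rho: see [qCR_null]. *)
Definition distV (p : M) : set vec := null_form2 (rho 0) p.

Record qCR (U : set M) : Prop := QCR {
  qCR_open : open U;
  qCR_smooth : forall a, smooth_form U (omega a);
  qCR_rank : forall p, U p -> has_rank (4 * n) (distD p);
  qCR_span : forall p v, U p -> tangent p v ->
    exists W (k : nat) (X : field) (Y Z : 'I_k -> field),
      [/\ [/\ open W, W p & W `<=` U],
          sectionD W X,
          (forall i, sectionD W (Y i)), (forall i, sectionD W (Z i)) &
          forall f, v f = X p f + \sum_(i < k) bracket (Y i) (Z i) p f];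
  qCR_nondegenerate : forall a p X, U p -> local_sectionD p X ->
    (forall Y, local_sectionD p Y -> ext_d (omega a) X Y p = 0) ->
    X p = (fun=> 0);
  qCR_J_distD : forall a p v, U p -> distD p v -> distD p (J a p v);
  qCR_J_linear : forall a p (c : R) v w, U p -> distD p v -> distD p w ->
    J a p (vadd (vscale c v) w) = vadd (vscale c (J a p v)) (J a p w);
  qCR_J_smooth : forall a O X, open O -> O `<=` U -> sectionD O X ->
    sectionD O (apply_endo (J a) X);
  qCR_J : forall a p X Y, U p -> local_sectionD p X -> local_sectionD p Y ->
    ext_d (omega (a + 1)) (apply_endo (J (a + 2)) X) Y p
    = ext_d (omega a) X Y p;
  qCR_J_square : forall a p v, U p -> distD p v ->
    J a p (J a p v) = vscale (-1) v;
  qCR_J_quaternion : forall a p v, U p -> distD p v ->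
    J a p (J (a + 1) p v) = J (a + 2) p v /\
    J (a + 1) p (J a p v) = vscale (-1) (J (a + 2) p v);
  qCR_null : forall a p, U p -> null_form2 (rho a) p = distV p;
  qCR_V_rank : forall p, U p -> has_rank 3 (distV p);
  qCR_V_complement : forall p, U p ->
    distD p `&` distV p = [set (fun=> 0)] /\
    (forall v, tangent p v ->
      exists x y, [/\ distD p x, distV p y & v = vadd x y]) }.

(* The expression sigma_a(J_a X, Y) does not depend on a. *)
Definition gD (X Y : field) : M -> R :=
  ext_d (omega 0) (apply_endo (J 0) X) Y.

Section Frame.
Variables (e : 'I_(4 * n) -> field) (theta : 'I_(4 * n) -> form1).

Definition gmx (p : M) : 'M[R]_(4 * n) := \matrix_(i, j) gD (e i) (e j) p.

(* gD is not assumed to be definite, so orthonormality is understood in the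
   pseudo-Riemannian sense. *)
Record adapted_frame (W : set M) : Prop := AdaptedFrame {
  frame_open : open W;
  frame_section : forall i, sectionD W (e i);
  frame_basis : forall p v, W p -> distD p v ->
    exists c : 'I_(4 * n) -> R, v = vcomb c (fun i => e i p);
  frame_orthogonal : forall p i j, W p -> i != j -> gmx p i j = 0;
  frame_normal : forall p i, W p -> gmx p i i = 1 \/ gmx p i i = -1;
  coframe_smooth : forall i, smooth_form W (theta i);
  coframe_dual : forall p i j, W p -> theta i p (e j p) = (i == j)%:R;
  coframe_V : forall p i v, W p -> distV p v -> theta i p v = 0 }.

Definition theta_low (j : 'I_(4 * n)) : form1 := fun p v =>
  \sum_k gmx p j k * theta k p v.

Definition gtilde (p : M) (v w : vec) : R :=
  \sum_(a < 3) omega a p v * omega a p w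
  + \sum_i \sum_j gmx p i j * theta i p v * theta j p w.

(* The matrix (J^a_ij), and the matrix with entry (J^a)^i_j in row i and
   column j. *)
Definition Jlow (a : 'I_3) (p : M) : 'M[R]_(4 * n) :=
  \matrix_(i, j) gD (apply_endo (J a) (e i)) (e j) p.
Definition Jmix (a : 'I_3) (p : M) : 'M[R]_(4 * n) :=
  invmx (gmx p) *m Jlow a p.

Definition tau (a : 'I_3) (i : 'I_(4 * n)) : form1 := fun p v =>
  \sum_j Jmix a p i j * theta j p v.

Variable nabla : connection M.

(* [phi i j] is the form with upper index i and lower index j. *)
Definition phi (i j : 'I_(4 * n)) : form1 := fun p v =>
  theta i p (nabla p v (e j)).

Definition congr_omega (W : set M) (s t : form2) : Prop :=
  exists eta : 'I_3 -> form1, (forall a, smooth_form W (eta a)) /\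
    forall p X Y, W p -> local_vfield p X -> local_vfield p Y ->
      s X Y p - t X Y p = \sum_(a < 3) wedge (omega a) (eta a) X Y p.

(* [T i j k l] is the component with upper index i and lower indices j k l. *)
Definition tensor := 'I_(4 * n) -> 'I_(4 * n) -> 'I_(4 * n) -> 'I_(4 * n) ->
  M -> R.

Definition skew (W : set M) (T : tensor) : Prop :=
  forall i j k l p, W p -> T i j k l p = - T i j l k p.

Definition half_theta2 (T : tensor) (i j : 'I_(4 * n)) : form2 := fun X Y p =>
  2^-1 * \sum_k \sum_l T i j k l p * wedge (theta k) (theta l) X Y p.

Definition curvature_form (i j : 'I_(4 * n)) : form2 := fun X Y p =>
  ext_d (phi i j) X Y p
  - \sum_s wedge (phi s j) (phi i s) X Y p
  + \sum_(a < 3)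
      wedge (fun q v => \sum_k Jlow a q j k * theta k q v) (tau a i) X Y p
  - wedge (theta i) (theta_low j) X Y p.

Definition curvature (W : set M) (T : tensor) : Prop :=
  skew W T /\
  forall i j, congr_omega W (half_theta2 T i j) (curvature_form i j).

Section Conformal.
Variable lam : M -> quat R.

Definition Jlow' (a : 'I_3) (p : M) : 'M[R]_(4 * n) :=
  \sum_(b < 3) qrot (lam p) b a *: Jlow b p.

Definition nu' (a : 'I_3) (i : 'I_(4 * n)) : form1 := fun p v =>
  (qmod (lam p) ^+ 2)^-1 * \sum_(b < 3) qrot (lam p) b a * tau b i p v.

Definition curvature_form' (i j : 'I_(4 * n)) : form2 := fun X Y p =>
  ext_d (phi i j) X Y p
  - \sum_s wedge (phi s j) (phi i s) X Y p
  + \sum_(a < 3)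
      wedge (fun q v => \sum_k qmod (lam q) ^+ 2 * Jlow' a q j k * theta k q v)
            (nu' a i) X Y p
  - wedge (theta i) (theta_low j) X Y p.

(* The tensor of omega' = lam omega conj(lam).  It is built from the frame, the
   coframe and the connection forms of omega, not from those of omega'. *)
Definition curvature' (W : set M) (T : tensor) : Prop :=
  skew W T /\
  forall i j, congr_omega W (half_theta2 T i j) (curvature_form' i j).

End Conformal.

Definition tensor_eval (T : tensor) (p : M) (x y z : vec) : vec := fun f =>
  \sum_i \sum_j \sum_k \sum_l
    T i j k l p * theta j p x * theta k p y * theta l p z * e i p f.

End Frame.

End Structure.

Definition smooth_quat (W : set M) (lam : M -> quat R) : Prop :=
  [/\ smooth_on W (fun p => q0 (lam p)), smooth_on W (fun p => q1 (lam p)),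
      smooth_on W (fun p => q2 (lam p)) & smooth_on W (fun p => q3 (lam p))].

Record conformal_change (W : set M) (lam : M -> quat R)
    (omega omega' : 'I_3 -> form1) : Prop := ConformalChange {
  change_smooth : smooth_quat W lam;
  change_neq0 : forall p, W p -> lam p <> qzero R;
  change_eq : forall p v, W p -> tangent p v ->
    qim (fun a => omega' a p v)
    = qmul (qmul (lam p) (qim (fun a => omega a p v))) (qconj (lam p)) }.

Record pseudo_conformal_qCR (I : Type) (U : I -> set M)
    (omega : I -> 'I_3 -> form1) (J : I -> 'I_3 -> M -> vec -> vec) : Prop :=
  PseudoConformalQCR {
    pc_cover : forall p, exists s, U s p;
    pc_local : forall s, qCR (omega s) (J s) (U s);
    pc_change : forall s t, exists lam,
      conformal_change (U s `&` U t) lam (omega s) (omega t) }.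

End QuaternionicCR.

(* Main.v *)
Require Import Defs.
From mathcomp Require Import all_boot all_order all_algebra.
From mathcomp Require Import boolp classical_sets functions cardinality reals.
From mathcomp Require Import topology normedtype derive.
From mathcomp Require Import filter.
From mathcomp Require Import ring.

(** Since A is orthogonal, sum_a u^2 J'^a (x) nu'_a = sum_a J^a (x) tau_a, so
    the forms defining T and T' coincide.  It remains to see that T, as a tensor
    on D, does not depend on the adapted frame.  On sections of D the form
    d omega_1 is -1/2 omega_1([X, Y]), hence C^oo-bilinear, so g^D and the J^a
    transform by the matrix H with e' = e H; thus the metric g~, and by Koszul
    uniqueness its connection, is the same for both frames.  The connection
    matrices then satisfy H phi' = dH + phi H, whence H Omega' = Omega H, and
    tensoriality in the two arguments of the curvature form comes for free from
    the congruence modulo omega, evaluated on the vectors e'_k, e'_l. *)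

Import Order.TTheory GRing.Theory Num.Theory.
Import numFieldNormedType.Exports.

Local Open Scope classical_set_scope.

(** Fields and functions are total, but only their germs at a point carry information. An expansion
    [e' = e H] can be differentiated only if it holds on a neighbourhood, and a connection acts on
    fields rather than on values; this is why locality of tangent vectors and of connections comes
    before any change of frame. Two further obstacles shape the proof. Covariant derivatives of the
    frame fields need not stay in D; the distribution V, on which both coframes vanish, makes the
    relation between the coframes valid on all tangent vectors. And g^D may be indefinite, so H is
    treated as a merely invertible matrix: g^D and the lowered J^a change by congruence, and the
    laws are kept in the form H Omega' = Omega H, which never differentiates the inverse of H. *)

(** * Functions of class C^k on open sets of R^m *)

Section EuclideanSmoothness.
Set Implicit Arguments.
Unset Strict Implicit.
Local Open Scope ring_scope.
Variables (R : realType) (m : nat).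
Implicit Types (O : set 'rV[R]_m) (f g : 'rV[R]_m -> R).

Lemma class_C_sub k O O' f : O' `<=` O -> class_C k O f -> class_C k O' f.
Proof.
elim: k f => [|k IH] f sub /= [cf df].
  by split=> // x /sub; apply: cf.
split=> [x /sub|i]; first exact: cf.
have [d Cd] := df i; split=> [x /sub|]; first exact: d.
exact: IH.
Qed.

Lemma class_CS k O f : class_C k.+1 O f -> class_C k O f.
Proof.
elim: k f => [|k IH] f [cf df]; first by split.
split=> // i; have [d Cd] := df i; split=> //; exact: IH.
Qed.

Lemma near_eq_continuous (S T : topologicalType) (f g : S -> T) x :
  (\forall y \near x, f y = g y) ->
  {for x, continuous f} -> {for x, continuous g}.
Proof.
move=> fg cf; rewrite /prop_for /continuous_at -(nbhs_singleton fg).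
exact: cvg_trans (near_eq_cvg fg) cf.
Qed.

Lemma eq_class_C k O f g : open O -> (forall x, O x -> f x = g x) ->
  class_C k O f -> class_C k O g.
Proof.
move=> oO; elim: k f g => [|k IH] f g fg [cf df];
  (have nfg x : O x -> \near x, f x = g x;
    [by move=> Ox; apply: filterS (open_nbhs_nbhs (conj oO Ox)) => y; apply: fg
    |split=> [x Ox|//]; first exact: near_eq_continuous (nfg x Ox) (cf x Ox)]).
move=> i; have [d Cd] := df i; split=> [x Ox|].
  exact: near_eq_derivable (nfg x Ox) (d x Ox).
by apply: IH Cd => x Ox; apply: near_eq_derive; apply: nfg.
Qed.

Lemma class_C_cst k O (a : R) : open O -> class_C k O (fun=> a).
Proof.
move=> oO; elim: k a => [|k IH] a.
  by split=> // x _; exact: cst_continuous.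
split=> [x _|i]; first exact: cst_continuous.
split=> [x _|]; first exact: derivable_cst.
by apply: eq_class_C oO _ (IH 0) => x _; rewrite (derive_cst a).
Qed.

Lemma class_CD k O f g : open O -> class_C k O f -> class_C k O g ->
  class_C k O (fun x => f x + g x).
Proof.
move=> oO; elim: k f g => [|k IH] f g [cf df] [cg dg].
  by split=> // x Ox; apply: (cvgD (cf x Ox) (cg x Ox)).
split=> [x Ox|i]; first exact: (cvgD (cf x Ox) (cg x Ox)).
have [d Cd] := df i; have [d' Cd'] := dg i.
split=> [x Ox|]; first exact: derivableD (d x Ox) (d' x Ox).
apply: eq_class_C oO _ (IH _ _ Cd Cd') => x Ox.
by rewrite (deriveD (d x Ox) (d' x Ox)).
Qed.

Lemma class_CM k O f g : open O -> class_C k O f -> class_C k O g ->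
  class_C k O (fun x => f x * g x).
Proof.
move=> oO; elim: k f g => [|k IH] f g Cf Cg.
  by split=> // x Ox; apply: (cvgM (Cf.1 x Ox) (Cg.1 x Ox)).
have [cf df] := Cf; have [cg dg] := Cg.
split=> [x Ox|i]; first exact: (cvgM (cf x Ox) (cg x Ox)).
have [d Cd] := df i; have [d' Cd'] := dg i.
split=> [x Ox|]; first exact: derivableM (d x Ox) (d' x Ox).
(* In the product rule a derivative, of class k, meets the other factor undifferentiated, whose
   class k + 1 is lowered to k. *)
have := class_CD oO (IH _ _ (class_CS Cf) Cd') (IH _ _ (class_CS Cg) Cd).
by apply: eq_class_C oO _ => x Ox; rewrite (deriveM (d x Ox) (d' x Ox)).
Qed.

End EuclideanSmoothness.

(** * Germs of smooth functions, tangent vectors, vector fields and brackets *)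

Section Germs.
Set Implicit Arguments.
Unset Strict Implicit.
Local Open Scope ring_scope.
Variables (R : realType) (m : nat) (M : manifold R m).
Implicit Types (p : M) (W O : set M) (f g h : M -> R).

(** Inside the open image of the whole chart, the image of [W] is the preimage of [W] under the
    continuous local inverse. Openness is what allows a function to be replaced by an equal one
    under derivatives. *)
Lemma chart_img_open_sub c W : @atlas _ _ M c -> open W ->
  open (chart_img c W).
Proof.
move=> /atlas_chart[oD oI cK _ cI] oW.
rewrite openE => _ [q [Dq Wq] <-].
have Iq : chart_img c setT (chart_map c q) by exists q.
have nW : nbhs (chart_map c q) (chart_inv c @^-1` W).
  by apply: (cI _ Iq); rewrite (cK _ Dq); apply: open_nbhs_nbhs.
have nI := open_nbhs_nbhs (conj oI Iq).
apply: filterS2 nW nI => x Wx [r [Dr _] rx].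
by exists r => //; split=> //; move: Wx; rewrite /= -rx cK.
Qed.

Lemma smooth_on_sub W O f : O `<=` W -> smooth_on W f -> smooth_on O f.
Proof.
move=> OW sf c ac k; apply: class_C_sub (sf c ac k).
by move=> _ [q [Dq Oq] <-]; exists q => //; split=> //; apply: OW.
Qed.

Lemma eq_smooth_on W f g : open W -> (forall q, W q -> f q = g q) ->
  smooth_on W f -> smooth_on W g.
Proof.
move=> oW fg sf c ac k.
apply: eq_class_C (chart_img_open_sub ac oW) _ (sf c ac k).
move=> _ [q [Dq Wq] <-]; apply: fg.
by rewrite (chart_mapK (atlas_chart ac)).
Qed.

Lemma smooth_on_cst W (a : R) : open W -> @smooth_on _ _ M W (fun=> a).
Proof. by move=> oW c ac k; apply/class_C_cst/chart_img_open_sub. Qed.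

Lemma smooth_onD W f g : open W -> smooth_on W f -> smooth_on W g ->
  smooth_on W (fun q => f q + g q).
Proof.
move=> oW sf sg c ac k.
exact: class_CD (chart_img_open_sub ac oW) (sf c ac k) (sg c ac k).
Qed.

Lemma smooth_onM W f g : open W -> smooth_on W f -> smooth_on W g ->
  smooth_on W (fun q => f q * g q).
Proof.
move=> oW sf sg c ac k.
exact: class_CM (chart_img_open_sub ac oW) (sf c ac k) (sg c ac k).
Qed.

Lemma smooth_on_at p W f : open W -> W p -> smooth_on W f -> smooth_at p f.
Proof. by move=> *; exists W. Qed.

Lemma smooth_at_cst p (a : R) : smooth_at p (fun=> a).
Proof.
by exists setT; split=> //; [exact: openT|exact: smooth_on_cst openT].
Qed.

Lemma smooth_atD p f g : smooth_at p f -> smooth_at p g ->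
  smooth_at p (fun q => f q + g q).
Proof.
move=> [W [oW Wp sf]] [O [oO Op sg]]; exists (W `&` O).
split=> //; first exact: openI.
apply: smooth_onD; first exact: openI.
  exact: smooth_on_sub sf.
exact: smooth_on_sub sg.
Qed.

Lemma smooth_atM p f g : smooth_at p f -> smooth_at p g ->
  smooth_at p (fun q => f q * g q).
Proof.
move=> [W [oW Wp sf]] [O [oO Op sg]]; exists (W `&` O).
split=> //; first exact: openI.
apply: smooth_onM; first exact: openI.
  exact: smooth_on_sub sf.
exact: smooth_on_sub sg.
Qed.

Lemma smooth_atB p f g : smooth_at p f -> smooth_at p g ->
  smooth_at p (fun q => f q - g q).
Proof.
move=> sf sg.
have -> : (fun q => f q - g q) = (fun q => f q + -1 * g q).
  by apply: funext => q; rewrite mulN1r.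
by apply: smooth_atD => //; apply: smooth_atM => //; apply: smooth_at_cst.
Qed.

Lemma smooth_at_sum p (I : Type) (s : seq I) (f : I -> M -> R) :
  (forall i, smooth_at p (f i)) ->
  smooth_at p (fun q => \sum_(i <- s) f i q).
Proof.
move=> sf; elim: s => [|i s IH].
  have -> : (fun q => \sum_(i <- [::]) f i q) = (fun=> 0).
    by apply: funext => q; rewrite big_nil.
  exact: smooth_at_cst.
have -> : (fun q => \sum_(j <- i :: s) f j q)
        = (fun q => f i q + \sum_(j <- s) f j q).
  by apply: funext => q; rewrite big_cons.
exact: smooth_atD.
Qed.

Lemma nearP_open p (P : M -> Prop) : (\forall q \near p, P q) ->
  exists O, [/\ open O, O p & forall q, O q -> P q].
Proof.
move=> nP; move: (nP : nbhs p P).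
by rewrite nbhsE => -[O [oO Op] sub]; exists O.
Qed.

Lemma smooth_at_near p f : smooth_at p f -> \forall q \near p, smooth_at q f.
Proof.
move=> [W [oW Wp sf]].
by apply: filterS (open_nbhs_nbhs (conj oW Wp)) => q Wq; exists W.
Qed.

Lemma eq_smooth_at p f g : (\forall q \near p, f q = g q) ->
  smooth_at p f -> smooth_at p g.
Proof.
move=> /nearP_open[O [oO Op fg]] [W [oW Wp sf]]; exists (W `&` O).
split=> //; first exact: openI.
apply: (@eq_smooth_on _ f); first exact: openI.
  by move=> q [_]; apply: fg.
exact: smooth_on_sub sf.
Qed.

(** Multiplying by this function leaves unchanged anything that vanishes on [O]. It is smooth near
    the points of an open [O], so the Leibniz rules of tangent vectors and connections turn it into
    a proof of locality. *)
Definition away O : M -> R := fun q => if `[< O q >] then 0 else 1.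

Lemma away_in O q : O q -> away O q = 0.
Proof. by move=> Oq; rewrite /away asboolT. Qed.

Lemma smooth_at_away O p : open O -> O p -> smooth_at p (away O).
Proof.
move=> oO Op; apply: (@eq_smooth_at p (fun=> 0)); last exact: smooth_at_cst.
by apply: filterS (open_nbhs_nbhs (conj oO Op)) => q /away_in.
Qed.

Section Tangent.
Variables (p : M) (v : vec M).
Hypothesis tv : tangent p v.

Lemma tangent_cst0 : v (fun=> 0) = 0.
Proof.
have s0 := smooth_at_cst p 0.
have := tangent_linear tv 1 s0 s0; rewrite !mul1r addr0.
by move=> /eqP; rewrite -subr_eq subrr => /eqP.
Qed.

Lemma tangentD f g : smooth_at p f -> smooth_at p g ->
  v (fun q => f q + g q) = v f + v g.
Proof.
move=> sf sg; have := tangent_linear tv 1 sf sg; rewrite mul1r => <-.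
by congr v; apply: funext => q; rewrite mul1r.
Qed.

Lemma tangentB f g : smooth_at p f -> smooth_at p g ->
  v (fun q => f q - g q) = v f - v g.
Proof.
move=> sf sg; have := tangent_linear tv (-1) sg sf.
rewrite mulN1r addrC => <-; congr v; apply: funext => q.
by rewrite mulN1r addrC.
Qed.

Lemma tangent_sum (I : Type) (s : seq I) (f : I -> M -> R) :
  (forall i, smooth_at p (f i)) ->
  v (fun q => \sum_(i <- s) f i q) = \sum_(i <- s) v (f i).
Proof.
move=> sf; elim: s => [|i s IH].
  rewrite big_nil -[RHS]tangent_cst0.
  by congr v; apply: funext => q; rewrite big_nil.
rewrite big_cons -IH -tangentD //; last exact: smooth_at_sum.
by congr v; apply: funext => q; rewrite big_cons.
Qed.

(* Near p, f - g is its own product with a function vanishing near p, so the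
   Leibniz rule kills it. *)
Lemma eq_tangent f g : (\forall q \near p, f q = g q) -> v f = v g.
Proof.
move=> fg; have [sf|nsf] := pselect (smooth_at p f); last first.
  rewrite (tangent_junk tv nsf) (tangent_junk tv) // => sg; apply: nsf.
  by apply: eq_smooth_at sg; apply: filterS fg => q ->.
have sg := eq_smooth_at fg sf.
have [O [oO Op fgO]] := nearP_open fg.
apply/eqP; rewrite -subr_eq0 -tangentB //.
have -> : (fun q => f q - g q) = (fun q => away O q * (f q - g q)).
  apply: funext => q; rewrite /away; case: asboolP => [/fgO->|_].
    by rewrite mul0r subrr.
  by rewrite mul1r.
rewrite (tangent_leibniz tv) ?(fgO p) //; last exact: smooth_atB.
  by rewrite subrr mulr0 away_in // mul0r addr0.
exact: smooth_at_away.
Qed.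

Lemma tangent_near_cst0 f : (\forall q \near p, f q = 0) -> v f = 0.
Proof. by move=> f0; rewrite -[RHS]tangent_cst0; apply: eq_tangent. Qed.

End Tangent.

Lemma tangent0 p : tangent p (fun=> 0).
Proof. by split=> *; rewrite ?mulr0 ?mul0r ?addr0. Qed.

Lemma tangent_comb p a v w : tangent p v -> tangent p w ->
  tangent p (vadd (vscale a v) w).
Proof.
move=> tv tw; split=> [b f g sf sg|f g sf sg|f nf]; rewrite /vadd /vscale.
- by rewrite (tangent_linear tv) // (tangent_linear tw) //; ring.
- by rewrite (tangent_leibniz tv) // (tangent_leibniz tw) //; ring.
- by rewrite (tangent_junk tv) // (tangent_junk tw) // mulr0 addr0.
Qed.

Lemma tangent_vcomb p (I : Type) (s : seq I) (c : I -> R) (v : I -> vec M) :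
  (forall i, tangent p (v i)) ->
  tangent p (fun f => \sum_(i <- s) c i * v i f).
Proof.
move=> tv; elim: s => [|i s IH].
  have -> : (fun f => \sum_(i <- [::]) c i * v i f) = (fun=> 0).
    by apply: funext => q; rewrite big_nil.
  exact: tangent0.
have -> : (fun f => \sum_(j <- i :: s) c j * v j f)
   = vadd (vscale (c i) (v i)) (fun f => \sum_(j <- s) c j * v j f).
  by apply: funext => q; rewrite big_cons.
exact: tangent_comb.
Qed.

Section LocalFields.
Variable p : M.
Implicit Types (X Y : field M).

Lemma vfield_sub W O X : O `<=` W -> vfield W X -> vfield O X.
Proof.
move=> OW vX; split=> [q /OW|O' f oO' O'O]; first exact: vfield_tangent.
by apply: (vfield_smooth vX) => //; apply: subset_trans OW.
Qed.

Lemma local_tangent X : local_vfield p X -> tangent p (X p).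
Proof. by move=> [W [_ Wp vX]]; apply: (vfield_tangent vX). Qed.

Lemma local_vfield_near X : local_vfield p X ->
  \forall q \near p, local_vfield q X.
Proof.
move=> [W [oW Wp vX]].
by apply: filterS (open_nbhs_nbhs (conj oW Wp)) => q Wq; exists W.
Qed.

Lemma local_vfield_smooth X f : local_vfield p X -> smooth_at p f ->
  smooth_at p (fun q => X q f).
Proof.
move=> [W [oW Wp vX]] [O [oO Op sf]]; exists (W `&` O).
split=> //; first exact: openI.
apply: (vfield_smooth vX) => //; first exact: openI.
exact: smooth_on_sub sf.
Qed.

Lemma local_smooth_form W (eta : form1 M) X : open W -> W p ->
  smooth_form W eta -> local_vfield p X ->
  smooth_at p (fun q => eta q (X q)).
Proof.
move=> oW Wp [_ se] [O [oO Op vX]]; exists (W `&` O).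
split=> //; first exact: openI.
apply: se => //; first exact: openI.
exact: vfield_sub vX.
Qed.

Lemma local_vfield0 : local_vfield p (fun _ _ => 0).
Proof.
exists setT; split=> //; first exact: openT.
by split=> [q _|O f oO _ _]; [exact: tangent0|exact: smooth_on_cst].
Qed.

Lemma local_vfield_comb h X Y : smooth_at p h -> local_vfield p X ->
  local_vfield p Y -> local_vfield p (fun q => vadd (vscale (h q) (X q)) (Y q)).
Proof.
move=> [O1 [o1 p1 sh]] [O2 [o2 p2 vX]] [O3 [o3 p3 vY]].
exists (O1 `&` (O2 `&` O3)); split=> //.
  by apply: openI => //; apply: openI.
split=> [q [q1 [q2 q3]]|O f oO OW sf].
  by apply: tangent_comb; [apply: (vfield_tangent vX)|
    apply: (vfield_tangent vY)].
apply: smooth_onD => //; first apply: smooth_onM => //.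
- by apply: smooth_on_sub sh => q /OW[].
- by apply: (vfield_smooth vX) => // q /OW[? []].
- by apply: (vfield_smooth vY) => // q /OW[? []].
Qed.

Lemma local_vfield_sum (I : Type) (s : seq I) (h : I -> M -> R)
    (X : I -> field M) :
  (forall i, smooth_at p (h i)) -> (forall i, local_vfield p (X i)) ->
  local_vfield p (fun q f => \sum_(i <- s) h i q * X i q f).
Proof.
move=> sh lX; elim: s => [|i s IH].
  have -> : (fun q f => \sum_(i <- [::]) h i q * X i q f) = (fun _ _ => 0).
    by apply: funext => q; apply: funext => f; rewrite big_nil.
  exact: local_vfield0.
have -> : (fun q f => \sum_(j <- i :: s) h j q * X j q f)
  = (fun q => vadd (vscale (h i q) (X i q))
                   (fun f => \sum_(j <- s) h j q * X j q f)).
  by apply: funext => q; apply: funext => f; rewrite big_cons.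
exact: local_vfield_comb.
Qed.

Lemma bracketE X Y f : smooth_at p f ->
  bracket X Y p f = X p (fun q => Y q f) - Y p (fun q => X q f).
Proof. by move=> sf; rewrite /bracket asboolT. Qed.

Lemma bracket_anti X Y f : bracket X Y p f = - bracket Y X p f.
Proof. by rewrite /bracket; case: asboolP; rewrite ?oppr0 ?opprB. Qed.

End LocalFields.

(** The mixed terms X f * Y g and Y f * X g cancel in the commutator. The rules for the inner field
    are needed on a neighbourhood of [p], because the outer field differentiates them. *)
Lemma local_bracket_tangent p (X Y : field M) :
  local_vfield p X -> local_vfield p Y -> tangent p (bracket X Y p).
Proof.
move=> lX lY.
have tX := local_tangent lX; have tY := local_tangent lY.
have nX := local_vfield_near lX; have nY := local_vfield_near lY.
have sX k (sk : smooth_at p k) := local_vfield_smooth lX sk.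
have sY k (sk : smooth_at p k) := local_vfield_smooth lY sk.
split=> [a f g sf sg|f g sf sg|f nf]; last by rewrite /bracket asboolF.
- have sfg : smooth_at p (fun q => a * f q + g q).
    apply: smooth_atD => //; apply: smooth_atM => //; exact: smooth_at_cst.
  have lin Z : local_vfield p Z -> \forall q \near p,
      Z q (fun q => a * f q + g q) = a * Z q f + Z q g.
    move=> /local_vfield_near lZ.
    apply: filterS3 lZ (smooth_at_near sf) (smooth_at_near sg) => q lZq sfq sgq.
    exact (tangent_linear (local_tangent lZq) a sfq sgq).
  rewrite !bracketE // (eq_tangent tX (lin _ lY)) (eq_tangent tY (lin _ lX)).
  rewrite (tangent_linear tX a (sY _ sf) (sY _ sg)).
  by rewrite (tangent_linear tY a (sX _ sf) (sX _ sg)); ring.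
- have lei Z : local_vfield p Z -> \forall q \near p,
      Z q (fun q => f q * g q) = Z q f * g q + f q * Z q g.
    move=> /local_vfield_near lZ.
    apply: filterS3 lZ (smooth_at_near sf) (smooth_at_near sg) => q lZq sfq sgq.
    exact (tangent_leibniz (local_tangent lZq) sfq sgq).
  rewrite !bracketE //; last exact: smooth_atM.
  rewrite (eq_tangent tX (lei _ lY)) (eq_tangent tY (lei _ lX)).
  rewrite (tangentD tX (smooth_atM (sY _ sf) sg) (smooth_atM sf (sY _ sg))).
  rewrite (tangentD tY (smooth_atM (sX _ sf) sg) (smooth_atM sf (sX _ sg))).
  rewrite (tangent_leibniz tX (sY _ sf) sg) (tangent_leibniz tX sf (sY _ sg)).
  rewrite (tangent_leibniz tY (sX _ sf) sg) (tangent_leibniz tY sf (sX _ sg)).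
  ring.
Qed.

Lemma local_bracket p X Y : local_vfield p X -> local_vfield p Y ->
  local_vfield p (bracket X Y).
Proof.
move=> [W [oW Wp vX]] [O [oO Op vY]].
have oWO := openI oW oO.
exists (W `&` O); split=> //; split=> [q [Wq Oq]|V f oV VWO sf].
  by apply: local_bracket_tangent; [exists W|exists O].
have VW : V `<=` W by move=> q /VWO[].
have VO : V `<=` O by move=> q /VWO[].
apply: (@eq_smooth_on V
  (fun q => X q (fun r => Y r f) + -1 * Y q (fun r => X r f))) => //.
  move=> q Vq; rewrite bracketE ?mulN1r //; exact: smooth_on_at sf.
apply: smooth_onD => //.
  by apply: (vfield_smooth vX) => //; apply: (vfield_smooth vY).
apply: smooth_onM => //; first exact: smooth_on_cst.
by apply: (vfield_smooth vY) => //; apply: (vfield_smooth vX).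
Qed.

Lemma form1_sum W (eta : form1 M) p (I : Type) (s : seq I) (c : I -> R)
    (v : I -> vec M) : W p -> smooth_form W eta ->
  (forall i, tangent p (v i)) ->
  eta p (fun f => \sum_(i <- s) c i * v i f) = \sum_(i <- s) c i * eta p (v i).
Proof.
move=> Wp [lin _] tv; have t0 := tangent0 p.
elim: s => [|i s IH].
  (* Writing the zero vector as -1 * 0 + 0 gives eta(0) = - eta(0) + eta(0) = 0 from the linearity
     axiom alone. *)
  have -> : (fun f => \sum_(i <- [::]) c i * v i f)
     = vadd (vscale (-1) (fun _ : M -> R => 0)) (fun=> 0).
    by apply: funext => f; rewrite big_nil /vadd /vscale mulr0 addr0.
  by rewrite big_nil lin // mulN1r addNr.
rewrite big_cons -IH -lin //; last exact: tangent_vcomb.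
by congr (eta p _); apply: funext => f; rewrite big_cons.
Qed.

End Germs.

(** * Locality of connections and uniqueness of the Levi-Civita connection *)

Section Connections.
Set Implicit Arguments.
Unset Strict Implicit.
Local Open Scope ring_scope.
Variables (R : realType) (m : nat) (M : manifold R m).
Implicit Types (p : M) (W : set M) (X Y Z : field M).
Implicit Types (g : M -> vec M -> vec M -> R) (nabla : connection M).

(** As a total field, [Z] equals [away O] times [Z]. Both terms of the Leibniz rule then vanish: the
    first contains [Z p], the second [away O p]. *)
Lemma nabla_near0 W g nabla p v Z : Levi_Civita W g nabla -> W p ->
  tangent p v -> local_vfield p Z -> (\forall q \near p, Z q = (fun=> 0)) ->
  nabla p v Z = (fun=> 0).
Proof.
move=> LC Wp tv lZ /nearP_open[O [oO Op Z0]].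
have -> : Z = (fun q => vscale (away O q) (Z q)).
  apply: funext => q; apply: funext => f; rewrite /vscale /away.
  by case: asboolP => [/Z0->|_]; rewrite ?mul0r ?mul1r.
rewrite (LC_leibniz LC) //; last exact: smooth_at_away.
by apply: funext => f; rewrite /vadd /vscale away_in // Z0 // mulr0 mul0r addr0.
Qed.

Lemma eq_nabla W g nabla p v Y Z : Levi_Civita W g nabla -> W p ->
  tangent p v -> local_vfield p Y -> local_vfield p Z ->
  (\forall q \near p, Y q = Z q) -> nabla p v Y = nabla p v Z.
Proof.
move=> LC Wp tv lY lZ YZ.
pose D : field M := fun q => vadd (vscale (-1) (Z q)) (Y q).
have lD : local_vfield p D.
  by apply: local_vfield_comb => //; apply: smooth_at_cst.
have -> : Y = (fun q => vadd (D q) (Z q)).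
  apply: funext => q; apply: funext => f.
  by rewrite /D /vadd /vscale mulN1r addrAC addNr add0r.
rewrite (LC_additive LC) // (nabla_near0 LC) //.
  by apply: funext => f; rewrite /vadd add0r.
apply: filterS YZ => q YZq; apply: funext => f.
by rewrite /D /vadd /vscale YZq mulN1r addNr.
Qed.

Lemma nabla_sum W g nabla p v (I : Type) (s : seq I) (h : I -> M -> R)
    (X : I -> field M) : Levi_Civita W g nabla -> W p -> tangent p v ->
  (forall i, smooth_at p (h i)) -> (forall i, local_vfield p (X i)) ->
  nabla p v (fun q f => \sum_(i <- s) h i q * X i q f)
  = (fun f => \sum_(i <- s) (v (h i) * X i p f + h i p * nabla p v (X i) f)).
Proof.
move=> LC Wp tv sh lX; elim: s => [|i s IH].
  under eq_fun do under eq_fun do rewrite big_nil.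
  under [RHS]eq_fun do rewrite big_nil.
  rewrite (nabla_near0 LC) //; first exact: local_vfield0.
  by apply: nearW.
have -> : (fun q f => \sum_(j <- i :: s) h j q * X j q f)
  = (fun q => vadd (vscale (h i q) (X i q))
                   (fun f => \sum_(j <- s) h j q * X j q f)).
  by apply: funext => q; apply: funext => f; rewrite big_cons.
have lhX : local_vfield p (fun q => vscale (h i q) (X i q)).
  have -> : (fun q => vscale (h i q) (X i q))
     = (fun q => vadd (vscale (h i q) (X i q)) (fun=> 0)).
    by apply: funext => q; apply: funext => f; rewrite /vadd addr0.
  by apply: local_vfield_comb => //; apply: local_vfield0.
rewrite (LC_additive LC Wp tv lhX); last exact: local_vfield_sum.
rewrite (LC_leibniz LC) // IH.
by apply: funext => f; rewrite big_cons.
Qed.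

Lemma local_nabla W g nabla p X Y : Levi_Civita W g nabla -> open W -> W p ->
  local_vfield p X -> local_vfield p Y ->
  local_vfield p (fun q => nabla q (X q) Y).
Proof.
move=> LC oW Wp [O1 [o1 p1 vX]] [O2 [o2 p2 vY]].
exists (W `&` (O1 `&` O2)).
have oO : open (W `&` (O1 `&` O2)) by apply: openI => //; apply: openI.
split=> //; apply: (LC_smooth LC) => //.
- by apply: vfield_sub vX => q [_ []].
- by apply: vfield_sub vY => q [_ []].
Qed.

(* The difference S(X, Y) of the two derivatives is symmetric in X, Y by
   torsion-freeness, while g(S(X, Y), Z) is skew in Y, Z by metricity. *)
Lemma LC_unique W W' g g' nabla nabla' p X Y :
  Levi_Civita W g nabla -> Levi_Civita W' g' nabla' -> W p -> W' p ->
  (\forall q \near p, forall u w, tangent q u -> tangent q w ->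
     g q u w = g' q u w) ->
  (forall a u v w, tangent p u -> tangent p v -> tangent p w ->
     g p (vadd (vscale a u) v) w = a * g p u w + g p v w) ->
  (forall u w, g p u w = g p w u) ->
  (forall u, tangent p u ->
     (forall Z, local_vfield p Z -> g p u (Z p) = 0) -> u = (fun=> 0)) ->
  local_vfield p X -> local_vfield p Y ->
  nabla p (X p) Y = nabla' p (X p) Y.
Proof.
move=> LC LC' Wp W'p gg' glin gsym gnd lX lY.
pose S X Y := vadd (vscale (-1) (nabla' p (X p) Y)) (nabla p (X p) Y).
have tn A B : local_vfield p A -> local_vfield p B ->
    tangent p (nabla p (A p) B).
  by move=> lA lB; apply: (LC_tangent LC) => //; apply: local_tangent.
have tn' A B : local_vfield p A -> local_vfield p B ->
    tangent p (nabla' p (A p) B).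
  by move=> lA lB; apply: (LC_tangent LC') => //; apply: local_tangent.
have tS A B : local_vfield p A -> local_vfield p B -> tangent p (S A B).
  by move=> lA lB; apply: tangent_comb; [apply: tn'|apply: tn].
have Ssym A B : local_vfield p A -> local_vfield p B -> S A B = S B A.
  move=> lA lB; apply: funext => f; rewrite /S /vadd /vscale.
  have := LC_torsion LC Wp lA lB f; have := LC_torsion LC' W'p lA lB f.
  move=> <- e; apply/eqP; rewrite -subr_eq0.
  rewrite -(subrr (nabla' p (A p) B f - nabla' p (B p) A f)).
  by rewrite -{1}e; apply/eqP; ring.
have Sskew A B C : local_vfield p A -> local_vfield p B -> local_vfield p C ->
    g p (S A B) (C p) = - g p (S A C) (B p).
  move=> lA lB lC.
  have tA := local_tangent lA; have tB := local_tangent lB.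
  have tC := local_tangent lC.
  have gp u w : tangent p u -> tangent p w -> g p u w = g' p u w.
    exact: (nbhs_singleton gg').
  have nB := tn _ _ lA lB; have nB' := tn' _ _ lA lB.
  have nC := tn _ _ lA lC; have nC' := tn' _ _ lA lC.
  have e1 := LC_metric LC Wp tA lB lC; have e2 := LC_metric LC' W'p tA lB lC.
  have e : A p (fun q => g q (B q) (C q)) = A p (fun q => g' q (B q) (C q)).
    refine (eq_tangent tA _).
    apply: filterS3 gg' (local_vfield_near lB) (local_vfield_near lC).
    by move=> q gq lBq lCq; apply: gq; apply: local_tangent.
  move: e2; rewrite -e e1 -!gp // => {}e.
  rewrite !glin //.
  rewrite (gsym (nabla p (A p) C)) (gsym (nabla' p (A p) C)).
  apply/eqP; rewrite -subr_eq0.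
  by move/eqP: e; rewrite -subr_eq0 => /eqP <-; apply/eqP; ring.
have S0 : S X Y = (fun=> 0).
  apply: gnd => [|Z lZ]; first exact: tS.
  (* Alternating symmetry and skewness: (X,Y;Z) = (Y,X;Z) = -(Y,Z;X) = -(Z,Y;X) = (Z,X;Y) = (X,Z;Y)
     = -(X,Y;Z). *)
  have e : g p (S X Y) (Z p) = - g p (S X Y) (Z p).
    rewrite {1}Ssym // Sskew // (Ssym Y Z) // Sskew // (Ssym Z X) // opprK.
    by rewrite Sskew.
  (* The false disjunct gives the goal the shape of [mulrn_eq0]: it suffices that twice the value is
     0. *)
  apply/eqP; rewrite -[_ == 0]/((2 == 0)%N || _) -mulrn_eq0.
  by rewrite mulr2n {1}e addNr.
apply: funext => f; have /(congr1 (@^~ f)) := S0.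
by rewrite /S /vadd /vscale mulN1r addrC => /eqP; rewrite subr_eq0 => /eqP.
Qed.

End Connections.

(** * Matrix and summation identities for changes of frame *)

Section MatrixIdentities.
Set Implicit Arguments.
Unset Strict Implicit.
Local Open Scope ring_scope.
Variable R : realType.

Lemma sum_orthogonal k (A : 'M[R]_k) (x y : 'I_k -> R) : A *m A^T = 1%:M ->
  \sum_a (\sum_b A b a * x b) * (\sum_b A b a * y b) = \sum_a x a * y a.
Proof.
move=> AA; pose rx := \row_a x a; pose ry := \row_a y a.
transitivity (((rx *m A) *m (ry *m A)^T) 0 0).
  rewrite mxE; apply: eq_bigr => a _; rewrite !mxE.
  by congr (_ * _); apply: eq_bigr => b _; rewrite !mxE mulrC.
rewrite trmx_mul mulmxA -(mulmxA rx) AA mulmx1 mxE.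
by apply: eq_bigr => a _; rewrite !mxE.
Qed.

(* [A], [B] are the connection matrices along X, Y and [C] the one along the
   bracket; [G] is the change of gauge, [GX] its derivative along X and [GXY]
   the one along X of [GY]; [BA] is the derivative of [B] along X and [AB] that
   of [A] along Y.  Primes refer to the new gauge. *)
Lemma gauge_covariance k (A B C A' B' C' BA AB BA' AB' G GX GY GXY GYX :
    'M[R]_k) :
  G *m A' = GX + A *m G -> G *m B' = GY + B *m G ->
  G *m C' = GXY - GYX + C *m G ->
  GX *m B' + G *m BA' = GXY + (BA *m G + B *m GX) ->
  GY *m A' + G *m AB' = GYX + (AB *m G + A *m GY) ->
  G *m (BA' - AB' - C' + A' *m B' - B' *m A')
  = (BA - AB - C + A *m B - B *m A) *m G.
Proof.
move=> eA eB eC eBA eAB.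
have {}eBA : G *m BA' = GXY + (BA *m G + B *m GX) - GX *m B'.
  by rewrite -eBA addrAC subrr add0r.
have {}eAB : G *m AB' = GYX + (AB *m G + A *m GY) - GY *m A'.
  by rewrite -eAB addrAC subrr add0r.
have eAB' : G *m (A' *m B') = GX *m B' + (A *m GY + A *m B *m G).
  by rewrite mulmxA eA mulmxDl -mulmxA eB mulmxDr mulmxA.
have eBA' : G *m (B' *m A') = GY *m A' + (B *m GX + B *m A *m G).
  by rewrite mulmxA eB mulmxDl -mulmxA eA mulmxDr mulmxA.
rewrite !(mulmxBl, mulmxDl) !(mulmxBr, mulmxDr) eBA eAB eC eAB' eBA'.
move: (BA *m G) (AB *m G) (C *m G) (A *m B *m G) (B *m A *m G) (A *m GY)
  (B *m GX) (GX *m B') (GY *m A') => *.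
by apply/matrixP => i j; rewrite !mxE; ring.
Qed.

(** [A] changes as an endomorphism and [B] as a bilinear form; under the transpose, the factor [G^T]
    of [B'] becomes the [G] on the right. This is the law of the terms J^a (x) tau_a. *)
Lemma outer_change k (G A A' B B' : 'M[R]_k) (u v : 'cV[R]_k) :
  G *m A' = A *m G -> B' = G^T *m B *m G ->
  G *m (A' *m u *m (B' *m v)^T) = A *m (G *m u) *m (B *m (G *m v))^T *m G.
Proof. by move=> e1 ->; rewrite !trmx_mul trmxK !mulmxA e1. Qed.

(** Packing three indices into a triple makes a contraction of tensors a single exchange of sums. *)
Lemma sum3E (I : finType) (f : I -> I -> I -> R) :
  \sum_a \sum_b \sum_c f a b c = \sum_(t : I * I * I) f t.1.1 t.1.2 t.2.
Proof. by rewrite pair_bigA pair_bigA. Qed.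

Lemma sum3M (I : finType) (f g k : I -> R) :
  \sum_(t : I * I * I) f t.1.1 * g t.1.2 * k t.2
  = (\sum_a f a) * (\sum_a g a) * (\sum_a k a).
Proof.
rewrite -(sum3E (fun a b c => f a * g b * k c)) !mulr_suml.
apply: eq_bigr => a _; rewrite [f a * _]mulr_sumr mulr_suml.
by apply: eq_bigr => b _; rewrite mulr_sumr.
Qed.

End MatrixIdentities.

(** * Orthogonality of the matrix A of a quaternion *)

Section QuaternionRotation.
Set Implicit Arguments.
Unset Strict Implicit.
Local Open Scope ring_scope.
Variable R : realType.

Lemma qnorm_sqr (x : quat R) :
  qnorm x ^+ 2 = q0 x ^+ 2 + q1 x ^+ 2 + q2 x ^+ 2 + q3 x ^+ 2.
Proof. by rewrite /qnorm sqr_sqrtr // !addr_ge0 // sqr_ge0. Qed.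

Lemma qnorm_eq0 (x : quat R) : (qnorm x == 0) -> x = qzero R.
Proof.
move=> /eqP x0; have := qnorm_sqr x; rewrite x0 expr0n /=.
have g y := sqr_ge0 (y : R).
move/esym/eqP; rewrite !paddr_eq0 ?addr_ge0 // !sqrf_eq0.
by case: x {x0} => a b c d /= /andP[/andP[/andP[/eqP-> /eqP->] /eqP->] /eqP->].
Qed.

Lemma qrot_orthogonal (lam : quat R) : lam <> qzero R ->
  qrot lam *m (qrot lam)^T = 1%:M.
Proof.
move=> lam0; have r0 : qnorm lam != 0 by apply/negP => /qnorm_eq0.
have e : (qnorm lam)^-1 ^+ 2 * (q0 lam ^+ 2 + q1 lam ^+ 2 + q2 lam ^+ 2
         + q3 lam ^+ 2) = 1.
  by rewrite -qnorm_sqr -exprMn mulVf // expr1n.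
move: e; rewrite /qrot /qunit /qscale.
case: lam {lam0 r0} (qnorm lam)^-1 => a b c d r /=.
(* The factor 1/|lam| is absorbed into the coordinates, which become those of the unit quaternion;
   only a^2 + b^2 + c^2 + d^2 = 1 is retained. *)
rewrite !mulrDr -!exprMn.
move: (r * a) (r * b) (r * c) (r * d) => {}a {}b {}c {}d e.
apply/matrixP => i j; rewrite !mxE !big_ord_recl big_ord0 !mxE.
case: i => [[|[|[|//]]] hi]; case: j => [[|[|[|//]]] hj].
all: rewrite /qcoord /qim /qbasis /= /qmul /qim /= ?eqxx /=.
(* The off-diagonal entries of A A^T vanish identically; each diagonal one is the square of the
   squared norm. *)
all: first [by ring | transitivity ((a ^+ 2 + b ^+ 2 + c ^+ 2 + d ^+ 2) ^+ 2);
  [by ring | by rewrite e expr1n]].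
Qed.

End QuaternionRotation.

(** * Components of the curvature tensor, and T' = T in a fixed frame *)

Section Components.
Set Implicit Arguments.
Unset Strict Implicit.
Local Open Scope ring_scope.
Variables (R : realType) (n : nat) (M : manifold R (4 * n + 3)).
Variables (omega : 'I_3 -> form1 M) (J : 'I_3 -> M -> vec M -> vec M).
Implicit Types (p : M) (W : set M) (X Y : field M).

Lemma local_sectionD_vfield p X :
  local_sectionD omega p X -> local_vfield p X.
Proof. by move=> [W [oW Wp [vX _]]]; exists W. Qed.

Lemma local_sectionD_dist p X :
  local_sectionD omega p X -> distD omega p (X p).
Proof. by move=> [W [oW Wp [_ dX]]]; apply: dX. Qed.

Lemma local_sectionD_near p X : local_sectionD omega p X ->
  \forall q \near p, local_sectionD omega q X.
Proof.
move=> [W [oW Wp dX]].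
by apply: filterS (open_nbhs_nbhs (conj oW Wp)) => q Wq; exists W.
Qed.

Lemma congr_omega_sectionD W s t p X Y : congr_omega omega W s t -> W p ->
  local_sectionD omega p X -> local_sectionD omega p Y -> s X Y p = t X Y p.
Proof.
move=> [eta [_ st]] Wp dX dY; apply/eqP; rewrite -subr_eq0.
rewrite st //; try exact: local_sectionD_vfield.
apply/eqP; apply: big1 => a _; rewrite /wedge.
rewrite (local_sectionD_dist dX).2 (local_sectionD_dist dY).2.
by rewrite !mul0r subrr mulr0.
Qed.

Variables (e : 'I_(4 * n) -> field M) (theta : 'I_(4 * n) -> form1 M).

(** By skewness the two terms of each wedge contribute equally to the sum; this absorbs the 1/2 of
    [wedge], and only the 1/2 in front of T remains. *)
Lemma half_theta2_skew W (T : tensor M) i j X Y p : Defs.skew W T -> W p ->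
  half_theta2 theta T i j X Y p = 2^-1 * \sum_k \sum_l
    T i j k l p * theta k p (X p) * theta l p (Y p).
Proof.
move=> sk Wp; rewrite /half_theta2; congr (_ * _).
pose a k l := T i j k l p * theta k p (X p) * theta l p (Y p).
have swap : \sum_k \sum_l a k l
    = - \sum_k \sum_l T i j k l p * theta k p (Y p) * theta l p (X p).
  rewrite exchange_big /= -sumrN; apply: eq_bigr => k _.
  by rewrite -sumrN; apply: eq_bigr => l _; rewrite /a sk //; ring.
rewrite -/(a _ _); under eq_bigr do under eq_bigr do rewrite -/(a _ _).
transitivity (2^-1 * (\sum_k \sum_l a k l + \sum_k \sum_l a k l)).
  rewrite {2}swap -sumrB mulr_sumr; apply: eq_bigr => k _.
  rewrite -sumrB mulr_sumr; apply: eq_bigr => l _.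
  by rewrite /wedge /a; ring.
by field.
Qed.

Lemma tensor_components W (T : tensor M) (C : form2 M) i j X Y p :
  Defs.skew W T -> congr_omega omega W (half_theta2 theta T i j) C -> W p ->
  local_sectionD omega p X -> local_sectionD omega p Y ->
  C X Y p = 2^-1 * \sum_k \sum_l
    T i j k l p * theta k p (X p) * theta l p (Y p).
Proof.
move=> sk TC Wp dX dY.
by rewrite -(congr_omega_sectionD TC) // (half_theta2_skew _ _ _ _ sk).
Qed.

Section Frame.
Variable W : set M.
Hypothesis F : adapted_frame omega J e theta W.

Lemma frame_local i p : W p -> local_sectionD omega p (e i).
Proof.
move=> Wp; exists W; split=> //; first exact: frame_open F.
exact (frame_section F i).
Qed.

(** The forms [eta] in the congruence are arbitrary, but their terms vanish on D, so T is determined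
    by [C]. The 2 undoes the 1/2 in front of T. *)
Lemma frame_components (T : tensor M) (C : form2 M) i j k l p :
  Defs.skew W T -> congr_omega omega W (half_theta2 theta T i j) C -> W p ->
  T i j k l p = 2 * C (e k) (e l) p.
Proof.
move=> sk TC Wp.
rewrite (tensor_components sk TC Wp (frame_local k Wp) (frame_local l Wp)).
rewrite mulrA mulfV ?mul1r ?pnatr_eq0 //.
rewrite (bigD1 k) //= (bigD1 l) //= big1 ?big1 ?addr0.
- by rewrite !(coframe_dual F) // !eqxx !mulr1.
- move=> k' k'k; apply: big1 => l' _.
  by rewrite (coframe_dual F) // (negPf k'k) mulr0 mul0r.
- by move=> l' l'l; rewrite !(coframe_dual F) // (negPf l'l) mulr0.
Qed.

(** Both forms use the same [phi], so [lam] is never differentiated. It enters only through its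
    value at [p], where u^2 cancels u^-2. *)
Lemma curvature_form'E nabla (lam : M -> quat R) i j X Y p :
  lam p <> qzero R ->
  curvature_form' omega J e theta nabla lam i j X Y p
  = curvature_form omega J e theta nabla i j X Y p.
Proof.
move=> lam0; rewrite /curvature_form' /curvature_form; congr (_ + _ - _).
have r0 : qmod (lam p) ^+ 2 != 0.
  by rewrite expf_neq0 //; apply/negP => /qnorm_eq0.
pose al b v := \sum_k Jlow omega J e b p j k * theta k p v.
have alE a v : \sum_k qmod (lam p) ^+ 2 * Jlow' omega J e lam a p j k
      * theta k p v
    = qmod (lam p) ^+ 2 * \sum_b qrot (lam p) b a * al b v.
  rewrite mulr_sumr; under [RHS]eq_bigr do rewrite /al mulr_sumr mulr_sumr.
  rewrite exchange_big /=; apply: eq_bigr => k _.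
  rewrite /Jlow' summxE mulr_sumr mulr_suml; apply: eq_bigr => b _.
  by rewrite !mxE; ring.
rewrite /wedge -!mulr_sumr; congr (_ * _).
rewrite !sumrB; congr (_ - _);
  rewrite -[RHS](sum_orthogonal _ _ (qrot_orthogonal lam0));
  apply: eq_bigr => a _;
  by rewrite /= alE /nu' mulrACA mulfV // mul1r.
Qed.

Lemma curvature'_eq nabla (lam : M -> quat R) (T T' : tensor M) i j k l p :
  lam p <> qzero R -> W p ->
  curvature omega J e theta nabla W T ->
  curvature' omega J e theta nabla lam W T' ->
  T' i j k l p = T i j k l p.
Proof.
move=> lam0 Wp [sk TC] [sk' TC'].
rewrite (frame_components _ _ sk (TC i j) Wp).
by rewrite (frame_components _ _ sk' (TC' i j) Wp) curvature_form'E.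
Qed.

End Frame.
End Components.

(** * Linearity of d omega over functions, on sections of D *)

Section Tensoriality.
Set Implicit Arguments.
Unset Strict Implicit.
Local Open Scope ring_scope.
Variables (R : realType).

Lemma form1Z m (M : manifold R m) W (eta : form1 M) p a v : W p ->
  smooth_form W eta -> tangent p v -> eta p (vscale a v) = a * eta p v.
Proof.
move=> Wp se tv.
have := form1_sum [:: tt] (fun=> a) Wp se (fun _ : unit => tv).
rewrite big_seq1 => <-; congr (eta p _).
by apply: funext => f; rewrite big_seq1.
Qed.

Lemma form1D m (M : manifold R m) W (eta : form1 M) p v w : W p ->
  smooth_form W eta -> tangent p v -> tangent p w ->
  eta p (vadd v w) = eta p v + eta p w.
Proof.
move=> Wp [lin _] tv tw; rewrite -[eta p v]mul1r -lin //.
by congr (eta p _); apply: funext => f; rewrite /vadd /vscale mul1r.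
Qed.

(** The correction terms - Y(h_i) X_i are combinations of the X_i. For sections of D they are killed
    by omega, which is what makes d omega linear over functions there. *)
Lemma bracket_suml m (M : manifold R m) p (I : Type) (s : seq I)
    (h : I -> M -> R) (X : I -> field M) (X' Y : field M) :
  (forall i, smooth_at p (h i)) -> (forall i, local_vfield p (X i)) ->
  local_vfield p Y ->
  (\forall q \near p, X' q = fun f => \sum_(i <- s) h i q * X i q f) ->
  bracket X' Y p
  = vadd (fun f => \sum_(i <- s) h i p * bracket (X i) Y p f)
         (fun f => \sum_(i <- s) - Y p (h i) * X i p f).
Proof.
move=> sh lX lY X'E; apply: funext => f; rewrite /vadd -big_split /=.
have [sf|nsf] := pselect (smooth_at p f); last first.
  (* Where [f] is not smooth, brackets and tangent vectors are all 0 by convention. *)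
  rewrite /bracket asboolF // big1 // => i _.
  by rewrite (tangent_junk (local_tangent (lX i)) nsf) !mulr0 addr0.
rewrite bracketE // (nbhs_singleton X'E).
have -> : Y p (fun q => X' q f)
    = Y p (fun q => \sum_(i <- s) h i q * X i q f).
  by refine (eq_tangent (local_tangent lY) _); apply: filterS X'E => q ->.
have sX i := local_vfield_smooth (lX i) sf.
rewrite (tangent_sum (local_tangent lY)) => [|i]; last exact: smooth_atM.
rewrite -sumrB; apply: eq_bigr => i _.
rewrite bracketE // (tangent_leibniz (local_tangent lY) (sh i) (sX i)).
ring.
Qed.

Variables (n : nat) (M : manifold R (4 * n + 3)).
Variables (omega : 'I_3 -> form1 M) (J : 'I_3 -> M -> vec M -> vec M).
Variable U : set M.
Hypothesis H : qCR omega J U.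
Implicit Types (p : M) (W : set M) (X Y : field M).

Lemma distD_sum p (I : Type) (s : seq I) (c : I -> R) (v : I -> vec M) : U p ->
  (forall i, distD omega p (v i)) ->
  distD omega p (fun f => \sum_(i <- s) c i * v i f).
Proof.
move=> Up dv; have tv i := (dv i).1.
split=> [|a]; first exact: tangent_vcomb.
rewrite (form1_sum _ _ Up (qCR_smooth H a)) //; apply: big1 => i _.
by rewrite (dv i).2 mulr0.
Qed.

Lemma J_sum a p (I : Type) (s : seq I) (c : I -> R) (v : I -> vec M) : U p ->
  (forall i, distD omega p (v i)) ->
  J a p (fun f => \sum_(i <- s) c i * v i f)
  = (fun f => \sum_(i <- s) c i * J a p (v i) f).
Proof.
move=> Up dv; elim: s => [|i s IH].
  under eq_fun do rewrite big_nil.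
  under [RHS]eq_fun do rewrite big_nil.
  have d0 : distD omega p (fun=> 0).
    have := distD_sum [::] c Up dv.
    by under eq_fun do rewrite big_nil.
  have := qCR_J_linear H a (-1) Up d0 d0.
  have -> : vadd (vscale (-1) (fun _ : M -> R => 0)) (fun=> 0) = (fun=> 0).
    by apply: funext => f; rewrite /vadd /vscale mulr0 addr0.
  by move=> ->; apply: funext => f; rewrite /vadd /vscale mulN1r addNr.
have -> : (fun f => \sum_(j <- i :: s) c j * v j f)
  = vadd (vscale (c i) (v i)) (fun f => \sum_(j <- s) c j * v j f).
  by apply: funext => f; rewrite big_cons.
rewrite (qCR_J_linear H) // ?IH; last exact: distD_sum.
by apply: funext => f; rewrite big_cons.
Qed.

Lemma ext_d_sectionD a p X Y : U p ->
  local_sectionD omega p X -> local_sectionD omega p Y ->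
  ext_d (omega a) X Y p = - 2^-1 * omega a p (bracket X Y p).
Proof.
move=> Up dX dY; have lX := local_sectionD_vfield dX.
have lY := local_sectionD_vfield dY.
rewrite /ext_d (tangent_near_cst0 (local_tangent lX)); last first.
  by apply: filterS (local_sectionD_near dY) => q /local_sectionD_dist[].
rewrite (tangent_near_cst0 (local_tangent lY)); last first.
  by apply: filterS (local_sectionD_near dX) => q /local_sectionD_dist[].
by rewrite subrr sub0r mulrN mulNr.
Qed.

Lemma ext_d_anti a p X Y : U p ->
  local_sectionD omega p X -> local_sectionD omega p Y ->
  ext_d (omega a) X Y p = - ext_d (omega a) Y X p.
Proof.
move=> Up dX dY; rewrite !ext_d_sectionD //.
have -> : bracket X Y p = vscale (-1) (bracket Y X p).
  by apply: funext => f; rewrite bracket_anti /vscale mulN1r.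
rewrite (form1Z _ Up (qCR_smooth H a)); first by rewrite mulN1r mulrN.
exact (local_bracket_tangent (local_sectionD_vfield dY)
                             (local_sectionD_vfield dX)).
Qed.

Lemma ext_d_suml a p (I : Type) (s : seq I) (h : I -> M -> R)
    (X : I -> field M) X' Y : U p -> (forall i, smooth_at p (h i)) ->
  (forall i, local_sectionD omega p (X i)) ->
  local_sectionD omega p X' -> local_sectionD omega p Y ->
  (\forall q \near p, X' q = fun f => \sum_(i <- s) h i q * X i q f) ->
  ext_d (omega a) X' Y p = \sum_(i <- s) h i p * ext_d (omega a) (X i) Y p.
Proof.
move=> Up sh dX dX' dY X'E; rewrite ext_d_sectionD //.
have lX i := local_sectionD_vfield (dX i).
have lY := local_sectionD_vfield dY.
have tX i := local_tangent (lX i).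
have tB i := local_bracket_tangent (lX i) lY.
have so := qCR_smooth H a.
rewrite (bracket_suml sh lX lY X'E) (form1D Up so); try exact: tangent_vcomb.
rewrite !(form1_sum _ _ Up so) // [X in _ + X]big1 => [|i _]; last first.
  by rewrite (local_sectionD_dist (dX i)).2 mulr0.
rewrite addr0 mulr_sumr; apply: eq_bigr => i _.
by rewrite ext_d_sectionD // mulrCA.
Qed.

(** The two slots carry different families with the same coefficients: in the applications [B] is a
    frame and [A] its image under endomorphisms. Linearity in the second slot comes from the first
    by antisymmetry, whence the two uses of [ext_d_anti]. *)
Lemma ext_d_change a k p (h : 'I_k -> 'I_k -> M -> R)
    (A B A' B' : 'I_k -> field M) : U p ->
  (forall i j, smooth_at p (h i j)) ->
  (forall i, local_sectionD omega p (A i)) ->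
  (forall i, local_sectionD omega p (B i)) ->
  (forall i, local_sectionD omega p (A' i)) ->
  (forall i, local_sectionD omega p (B' i)) ->
  (forall j, \forall q \near p, A' j q = fun f => \sum_i h i j q * A i q f) ->
  (forall j, \forall q \near p, B' j q = fun f => \sum_i h i j q * B i q f) ->
  \matrix_(i, j) ext_d (omega a) (A' i) (B' j) p
  = (\matrix_(i, j) h i j p)^T *m (\matrix_(i, j) ext_d (omega a) (A i) (B j) p)
    *m (\matrix_(i, j) h i j p).
Proof.
move=> Up sh dA dB dA' dB' A'E B'E; apply/matrixP => i j.
rewrite -mulmxA !mxE (ext_d_suml a Up _ dA (dA' i) (dB' j) (A'E i)) //.
apply: eq_bigr => s _; rewrite !mxE; congr (_ * _).
rewrite ext_d_anti // (ext_d_suml a Up _ dB (dB' j) (dA s) (B'E j)) //.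
rewrite -sumrN; apply: eq_bigr => t _.
by rewrite !mxE ext_d_anti // mulrN opprK mulrC.
Qed.

End Tensoriality.

(** * Coframe and metric g~ of one adapted frame *)

Section FrameFacts.
Set Implicit Arguments.
Unset Strict Implicit.
Local Open Scope ring_scope.
Variables (R : realType) (n : nat) (M : manifold R (4 * n + 3)).
Variables (omega : 'I_3 -> form1 M) (J : 'I_3 -> M -> vec M -> vec M).
Variable U : set M.
Hypothesis H : qCR omega J U.
Implicit Types (p : M) (W : set M) (X Y : field M).

Definition theta_col (theta : 'I_(4 * n) -> form1 M) p v : 'cV[R]_(4 * n) :=
  \col_i theta i p v.

Section OneFrame.
Variables (e : 'I_(4 * n) -> field M) (theta : 'I_(4 * n) -> form1 M).
Variable W : set M.
Hypothesis F : adapted_frame omega J e theta W.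
Hypothesis WU : W `<=` U.

Lemma frame_tangent i p : W p -> tangent p (e i p).
Proof.
move=> Wp; exact: (local_sectionD_dist (frame_local F i Wp)).1.
Qed.

Lemma frame_expand p v : W p -> distD omega p v ->
  v = fun f => \sum_i theta i p v * e i p f.
Proof.
move=> Wp dv; have [c ->] := frame_basis F Wp dv.
apply: funext => f; apply: eq_bigr => i _; congr (_ * _).
rewrite (form1_sum _ _ Wp (coframe_smooth F i)) => [|j]; last first.
  exact: frame_tangent.
rewrite (bigD1 i) //= big1 => [|j ji].
  by rewrite (coframe_dual F) // eqxx mulr1 addr0.
by rewrite (coframe_dual F) // eq_sym (negPf ji) mulr0.
Qed.

Lemma distV_tangent p v : distV omega p v -> tangent p v.
Proof. by move=> [X [lX <- _]]; apply: local_tangent. Qed.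

Lemma theta_horizontal i p x y : W p -> distD omega p x -> distV omega p y ->
  theta i p (vadd x y) = theta i p x.
Proof.
move=> Wp dx Vy; rewrite (form1D Wp (coframe_smooth F i)) //.
- by rewrite (coframe_V F i Wp Vy) addr0.
- exact: dx.1.
- exact: distV_tangent.
Qed.

(** The matrix is diagonal with entries 1 or -1; this gives its invertibility in any signature. *)
Lemma gmx_sqr p : W p -> gmx omega J e p *m gmx omega J e p = 1%:M.
Proof.
move=> Wp; apply/matrixP => i j; rewrite mxE (bigD1 i) //= big1 => [|k ki].
  rewrite addr0 [RHS]mxE; have [<-|ij] := eqVneq i j.
    by case: (frame_normal F i Wp) => ->; rewrite ?mulr1 // mulrNN mulr1.
  by rewrite (frame_orthogonal F Wp ij) mulr0.
by rewrite (frame_orthogonal F Wp _) ?mul0r // eq_sym.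
Qed.

Lemma gmx_unit p : W p -> gmx omega J e p \in unitmx.
Proof. by move=> /gmx_sqr /mulmx1_unit[]. Qed.

Lemma gmx_sym p : W p -> (gmx omega J e p)^T = gmx omega J e p.
Proof.
move=> Wp; apply/matrixP => i j; rewrite mxE.
have [->//|ij] := eqVneq i j.
by rewrite !(frame_orthogonal F) // eq_sym.
Qed.

Lemma gtildeE p v w : gtilde omega J e theta p v w
  = \sum_(a < 3) omega a p v * omega a p w
  + ((theta_col theta p v)^T *m gmx omega J e p *m theta_col theta p w) 0 0.
Proof.
rewrite /gtilde; congr (_ + _); rewrite -mulmxA mxE; apply: eq_bigr => i _.
rewrite !mxE mulr_sumr; apply: eq_bigr => j _; rewrite !mxE; ring.
Qed.

Lemma theta_col_comb p a u v : W p -> tangent p u -> tangent p v ->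
  theta_col theta p (vadd (vscale a u) v)
  = a *: theta_col theta p u + theta_col theta p v.
Proof.
move=> Wp tu tv; apply/matrixP => i j; rewrite !mxE.
by rewrite (form_linear (coframe_smooth F i)).
Qed.

Lemma gtilde_linear p a u v w : W p ->
  tangent p u -> tangent p v -> tangent p w ->
  gtilde omega J e theta p (vadd (vscale a u) v) w
  = a * gtilde omega J e theta p u w + gtilde omega J e theta p v w.
Proof.
move=> Wp tu tv tw; rewrite !gtildeE theta_col_comb //.
rewrite linearD linearZ /= !mulmxDl -!scalemxAl mxE [X in _ + (X + _)]mxE.
rewrite mulrDr mulr_sumr addrACA -big_split /=; congr (_ + _).
apply: eq_bigr => b _.
by rewrite (form_linear (qCR_smooth H b)) //; [ring | exact: WU].
Qed.

Lemma gtilde_sym p v w : W p ->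
  gtilde omega J e theta p v w = gtilde omega J e theta p w v.
Proof.
move=> Wp; rewrite !gtildeE; congr (_ + _).
  by apply: eq_bigr => a _; rewrite mulrC.
have tr (A : 'M[R]_1) : A 0 0 = A^T 0 0 by rewrite mxE.
by rewrite tr !trmx_mul trmxK gmx_sym // mulmxA.
Qed.

(** Split u = x + y along D and V. Pairing u with y gives the sum of the squares omega_a(y)^2, since
    theta vanishes on V and omega on D; hence y lies in both D and V and is 0. Pairing with the
    frame then kills x, as [gmx] is invertible. *)
Lemma gtilde_nondegenerate p u : W p -> tangent p u ->
  (forall Z, local_vfield p Z -> gtilde omega J e theta p u (Z p) = 0) ->
  u = (fun=> 0).
Proof.
move=> Wp tu u0; have Up := WU Wp.
have [DV dec] := qCR_V_complement H Up.
have [x [y [dx Vy uE]]] := dec u tu.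
have ty := distV_tangent Vy.
have tc0 : theta_col theta p y = 0.
  by apply/matrixP => i j; rewrite !mxE (coframe_V F).
have oE a : omega a p u = omega a p y.
  by rewrite uE (form1D Up (qCR_smooth H a)) // ?dx.2 ?add0r //; exact: dx.1.
have oy a : omega a p y = 0.
  have : gtilde omega J e theta p u y = 0.
    (* Only values of local fields may be tested; a vector of V is such a value by the definition of
       [null_form2]. *)
    by have [Z [lZ <- _]] := Vy; apply: u0.
  rewrite gtildeE tc0 mulmx0 mxE addr0 => /eqP.
  rewrite psumr_eq0 => [|b _]; last by rewrite oE -expr2 sqr_ge0.
  move=> /allP/(_ a); rewrite mem_index_enum oE -expr2 sqrf_eq0.
  by move=> /(_ isT)/eqP.
have y0 : y = (fun=> 0).
  by have : (distD omega p `&` distV omega p) y by []; rewrite DV.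
have {uE} ux : u = x.
  by rewrite uE y0; apply: funext => f; rewrite /vadd addr0.
have tx0 : (theta_col theta p x)^T *m gmx omega J e p = 0.
  apply/matrixP => i j; rewrite ord1 [RHS]mxE.
  rewrite -[RHS](u0 (e j)); last first.
    exact: local_sectionD_vfield (frame_local F j Wp).
  rewrite gtildeE big1 => [|a _]; last by rewrite oE oy mul0r.
  have -> : theta_col theta p (e j p) = delta_mx j 0.
    by apply/matrixP => k l; rewrite !mxE (coframe_dual F) // ord1 eqxx andbT.
  by rewrite add0r ux -colE [RHS]mxE.
have {}tx0 : (theta_col theta p x)^T = 0.
  by rewrite -[LHS](mulmxK (gmx_unit Wp)) tx0 mul0mx.
rewrite ux (frame_expand Wp dx); apply: funext => f; apply: big1 => i _.
move/matrixP: tx0 => /(_ 0 i); rewrite !mxE => ->; exact: mul0r.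
Qed.

Lemma local_sectionD_J a p X : U p -> local_sectionD omega p X ->
  local_sectionD omega p (apply_endo (J a) X).
Proof.
move=> Up [O [oO Op [vX dX]]]; have oU := qCR_open H.
exists (O `&` U); split=> //; first exact: openI.
apply: (qCR_J_smooth H) => //; first exact: openI.
split=> [|q [Oq _]]; last exact: dX.
by apply: vfield_sub vX => q [].
Qed.

End OneFrame.
End FrameFacts.

(** * Curvature under a change of adapted frame *)

Section FrameChange.
Set Implicit Arguments.
Unset Strict Implicit.
Local Open Scope ring_scope.
Variables (R : realType) (n : nat) (M : manifold R (4 * n + 3)).
Variables (omega : 'I_3 -> form1 M) (J : 'I_3 -> M -> vec M -> vec M).
Implicit Types (p : M) (X Y : field M).

Definition phi_mx (e : 'I_(4 * n) -> field M) (theta : 'I_(4 * n) -> form1 M)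
    nabla p v : 'M[R]_(4 * n) :=
  \matrix_(i, j) phi e theta nabla i j p v.

Definition dphi_mx (e : 'I_(4 * n) -> field M) (theta : 'I_(4 * n) -> form1 M)
    nabla X Y p : 'M[R]_(4 * n) :=
  \matrix_(i, j) X p (fun q => phi e theta nabla i j q (Y q)).

(** The products of phi have the lower index in the first factor, which reverses the matrix product;
    with the minus sign they give the commutator of [P (X p)] and [P (Y p)]. The factor 2^-1 is
    common to [ext_d] and [wedge]. *)
Lemma curvature_mxE (e : 'I_(4 * n) -> field M)
    (theta : 'I_(4 * n) -> form1 M) nabla X Y p :
  let P := phi_mx e theta nabla p in
  let x := theta_col theta p (X p) in
  let y := theta_col theta p (Y p) in
  \matrix_(i, j) curvature_form omega J e theta nabla i j X Y p
  = 2^-1 *: (dphi_mx e theta nabla X Y p - dphi_mx e theta nabla Y X p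
       - P (bracket X Y p) + P (X p) *m P (Y p) - P (Y p) *m P (X p)
       + \sum_(a < 3)
           (Jmix omega J e a p *m y *m (Jlow omega J e a p *m x)^T
            - Jmix omega J e a p *m x *m (Jlow omega J e a p *m y)^T)
       - (x *m (gmx omega J e p *m y)^T - y *m (gmx omega J e p *m x)^T)).
Proof.
move=> P x y; apply/matrixP => i j; rewrite !mxE /curvature_form.
have col (A : 'M[R]_(4 * n)) v k :
    (A *m theta_col theta p v) k 0 = \sum_l A k l * theta l p v.
  by rewrite mxE; apply: eq_bigr => l _; rewrite mxE.
have out (u v : 'cV[R]_(4 * n)) : (u *m v^T) i j = u i 0 * v j 0.
  by rewrite mxE big_ord1 !mxE.
rewrite summxE.
have -> : \sum_(a < 3) wedge
      (fun q v => \sum_k Jlow omega J e a q j k * theta k q v)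
      (tau omega J e theta a i) X Y p
    = 2^-1 * \sum_(a < 3)
           (Jmix omega J e a p *m y *m (Jlow omega J e a p *m x)^T
            - Jmix omega J e a p *m x *m (Jlow omega J e a p *m y)^T) i j.
  rewrite mulr_sumr; apply: eq_bigr => a _.
  by rewrite mxE [X in _ + X]mxE !out !col /wedge /tau; ring.
have -> : \sum_s wedge (phi e theta nabla s j) (phi e theta nabla i s) X Y p
    = 2^-1 * (\sum_s P (Y p) i s * P (X p) s j
            - \sum_s P (X p) i s * P (Y p) s j).
  rewrite -sumrB mulr_sumr; apply: eq_bigr => s _.
  by rewrite !mxE /wedge; ring.
have -> : wedge (theta i) (theta_low omega J e theta j) X Y p
    = 2^-1 * (x i 0 * (gmx omega J e p *m y) j 0
            - y i 0 * (gmx omega J e p *m x) j 0).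
  by rewrite !col !mxE /wedge /theta_low; ring.
rewrite !big_ord1 !mxE /ext_d; ring.
Qed.

Lemma phi_smooth e theta W nabla (p : M) i j Y :
  adapted_frame omega J e theta W ->
  Levi_Civita W (gtilde omega J e theta) nabla -> W p -> local_vfield p Y ->
  smooth_at p (fun q => phi e theta nabla i j q (Y q)).
Proof.
move=> F LC Wp lY.
have le := local_sectionD_vfield (frame_local F j Wp).
have ln := local_nabla LC (frame_open F) Wp lY le.
exact (local_smooth_form (frame_open F) Wp (coframe_smooth F i) ln).
Qed.

Variable U : set M.
Hypothesis H : qCR omega J U.
Variables (e e' : 'I_(4 * n) -> field M) (theta theta' : 'I_(4 * n) -> form1 M).
Variables (W W' : set M).
Hypotheses (F : adapted_frame omega J e theta W)
  (F' : adapted_frame omega J e' theta' W').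
Hypothesis WU : W `<=` U.

Definition frame_mx p : 'M[R]_(4 * n) := \matrix_(i, j) theta i p (e' j p).

(** On D this is the expansion in the frame [e']. It extends to every tangent vector because both
    coframes vanish on the same V, and it is later applied to covariant derivatives, which may leave
    D. *)
Lemma theta_col_change p v : W p -> W' p -> tangent p v ->
  theta_col theta p v = frame_mx p *m theta_col theta' p v.
Proof.
move=> Wp W'p tv.
have [x [y [dx Vy ->]]] := (qCR_V_complement H (WU Wp)).2 v tv.
apply/matrixP => i k; rewrite !mxE (theta_horizontal F) //.
under eq_bigr do rewrite [X in _ * X]mxE (theta_horizontal F') //.
rewrite {1}(frame_expand F' W'p dx) (form1_sum _ _ Wp (coframe_smooth F i)).
  by apply: eq_bigr => j _; rewrite mxE mulrC.
by move=> j; apply: frame_tangent F' _ _ _.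
Qed.

Lemma frame_mx_unit p : W p -> W' p -> frame_mx p \in unitmx.
Proof.
move=> Wp W'p.
suff /mulmx1_unit[] : frame_mx p *m (\matrix_(i, j) theta' i p (e j p)) = 1%:M.
  by [].
apply/matrixP => i j.
have /matrixP/(_ i 0) := theta_col_change Wp W'p (frame_tangent F j Wp).
rewrite !mxE (coframe_dual F) // => ->.
by apply: eq_bigr => k _; rewrite !mxE.
Qed.

Lemma frame_change p j : W p -> W' p ->
  e' j p = fun f => \sum_i theta i p (e' j p) * e i p f.
Proof.
move=> Wp W'p; apply: (frame_expand F Wp).
exact (local_sectionD_dist (frame_local F' j W'p)).
Qed.

Lemma near_overlap p : W p -> W' p -> \forall q \near p, W q /\ W' q.
Proof.
move=> Wp W'p; have n1 := open_nbhs_nbhs (conj (frame_open F) Wp).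
have n2 := open_nbhs_nbhs (conj (frame_open F') W'p).
by apply: filterS2 n1 n2.
Qed.

Lemma frame_smooth p i j : W p -> W' p ->
  smooth_at p (fun q => theta i q (e' j q)).
Proof.
move=> Wp W'p.
apply: (local_smooth_form (frame_open F) Wp (coframe_smooth F i)).
exact (local_sectionD_vfield (frame_local F' j W'p)).
Qed.

(** Taking [K] to be J_0 gives g^D, and taking it to be J_0 J_a gives the lowered J^a. *)
Lemma pairing_change (K : field M -> field M) p : W p -> W' p ->
  (forall q X, U q -> local_sectionD omega q X ->
     local_sectionD omega q (K X)) ->
  (forall j, \forall q \near p, K (e' j) q
     = fun f => \sum_i theta i q (e' j q) * K (e i) q f) ->
  \matrix_(i, j) ext_d (omega 0) (K (e' i)) (e' j) p
  = (frame_mx p)^T *m (\matrix_(i, j) ext_d (omega 0) (K (e i)) (e j) p)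
    *m frame_mx p.
Proof.
move=> Wp W'p KD KE; have Up := WU Wp.
rewrite (ext_d_change H 0 (p := p) (h := fun i j q => theta i q (e' j q))
  (A := fun i => K (e i)) (B := e) (A' := fun i => K (e' i)) (B' := e') Up) //.
- by move=> i j; apply: frame_smooth.
- by move=> i; apply: KD => //; apply: (frame_local F).
- by move=> i; apply: (frame_local F).
- by move=> i; apply: KD => //; apply: (frame_local F').
- by move=> i; apply: (frame_local F').
- move=> j; apply: filterS (near_overlap Wp W'p) => q [Wq W'q].
  exact: frame_change.
Qed.

Lemma J_frame_change a q j : W q -> W' q ->
  apply_endo (J a) (e' j) q
  = fun f => \sum_i theta i q (e' j q) * apply_endo (J a) (e i) q f.
Proof.
move=> Wq W'q; rewrite /apply_endo {1}(frame_change j Wq W'q).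
rewrite (J_sum H) //; first exact: WU.
by move=> i; exact (local_sectionD_dist (frame_local F i Wq)).
Qed.

Lemma gmx_change p : W p -> W' p ->
  gmx omega J e' p = (frame_mx p)^T *m gmx omega J e p *m frame_mx p.
Proof.
move=> Wp W'p; apply: (@pairing_change (apply_endo (J 0))) => //.
  by move=> q X Uq; apply: (local_sectionD_J H).
move=> j; apply: filterS (near_overlap Wp W'p) => q [Wq W'q].
exact: J_frame_change.
Qed.

Lemma Jlow_change a p : W p -> W' p ->
  Jlow omega J e' a p = (frame_mx p)^T *m Jlow omega J e a p *m frame_mx p.
Proof.
move=> Wp W'p.
apply: (@pairing_change (fun X => apply_endo (J 0) (apply_endo (J a) X))) => //.
  move=> q X Uq dX.
  exact (local_sectionD_J H 0 Uq (local_sectionD_J H a Uq dX)).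
move=> j; apply: filterS (near_overlap Wp W'p) => q [Wq W'q].
rewrite {1}/apply_endo J_frame_change // (J_sum H) //; first exact: WU.
move=> i; apply: (qCR_J_distD H); first exact: WU.
exact (local_sectionD_dist (frame_local F i Wq)).
Qed.

Lemma gtilde_change p v w : W p -> W' p -> tangent p v -> tangent p w ->
  gtilde omega J e theta p v w = gtilde omega J e' theta' p v w.
Proof.
move=> Wp W'p tv tw; rewrite !gtildeE gmx_change // !theta_col_change //.
by rewrite trmx_mul !mulmxA.
Qed.

Variables (nabla nabla' : connection M).
Hypotheses (LC : Levi_Civita W (gtilde omega J e theta) nabla)
  (LC' : Levi_Civita W' (gtilde omega J e' theta') nabla').

Let h i j q := theta i q (e' j q).
(** Here [v] is any operator on functions: it will also be the second derivative X(Y f), which is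
    not a tangent vector. *)
Let dh_mx p (v : vec M) : 'M[R]_(4 * n) := \matrix_(i, j) v (h i j).

Lemma nabla_change p X Y : W p -> W' p -> local_vfield p X ->
  local_vfield p Y -> nabla p (X p) Y = nabla' p (X p) Y.
Proof.
move=> Wp W'p lX lY.
apply: (LC_unique LC LC' Wp W'p _ _ _ _ lX lY).
- apply: filterS (near_overlap Wp W'p) => q [Wq W'q] u w tu tw.
  exact (gtilde_change Wq W'q tu tw).
- by move=> a u v w; apply: (gtilde_linear H F WU).
- by move=> u w; apply: (gtilde_sym F).
- by move=> u; apply: (gtilde_nondegenerate H F WU).
Qed.

Lemma phi_change p X : W p -> W' p -> local_vfield p X ->
  frame_mx p *m phi_mx e' theta' nabla' p (X p)
  = dh_mx p (X p) + phi_mx e theta nabla p (X p) *m frame_mx p.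
Proof.
move=> Wp W'p lX; apply/matrixP => i j.
have tX := local_tangent lX.
have le' := local_sectionD_vfield (frame_local F' j W'p).
have le k := local_sectionD_vfield (frame_local F k Wp).
have sh k : smooth_at p (h k j) by apply: frame_smooth.
have lhe := local_vfield_sum (index_enum _) sh le.
have tn k := LC_tangent LC Wp tX (le k).
have te k := frame_tangent F k Wp.
have nE : nabla' p (X p) (e' j)
    = vadd (fun f => \sum_k X p (h k j) * e k p f)
           (fun f => \sum_k h k j p * nabla p (X p) (e k) f).
  rewrite -nabla_change //.
  rewrite (eq_nabla LC Wp tX le' lhe); last first.
    apply: filterS (near_overlap Wp W'p) => q [Wq W'q].
    exact: frame_change.
  rewrite (nabla_sum _ LC) //.
  by apply: funext => f; rewrite big_split.
have tn' : tangent p (nabla' p (X p) (e' j)) by apply: (LC_tangent LC').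
have /matrixP/(_ i 0) := theta_col_change Wp W'p tn'.
rewrite mxE [in RHS]mxE => thE.
transitivity (theta i p (nabla' p (X p) (e' j))).
  by rewrite thE mxE; apply: eq_bigr => k _; rewrite !mxE.
have st := coframe_smooth F i.
rewrite nE (form1D Wp st); try exact: tangent_vcomb.
rewrite !(form1_sum _ _ Wp st) // mxE; congr (_ + _).
  rewrite (bigD1 i) //= big1 => [|k ki]; rewrite (coframe_dual F) //.
    by rewrite eqxx mulr1 addr0 mxE.
  by rewrite eq_sym (negPf ki) mulr0.
by rewrite mxE; apply: eq_bigr => k _; rewrite !mxE mulrC.
Qed.

(** This is the derivative along [X] of the law [phi_change] for [Y], which holds near [p], with the
    Leibniz rule applied to the products on both sides. *)
Lemma dphi_change p X Y : W p -> W' p -> local_vfield p X ->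
  local_vfield p Y ->
  dh_mx p (X p) *m phi_mx e' theta' nabla' p (Y p)
    + frame_mx p *m dphi_mx e' theta' nabla' X Y p
  = dh_mx p (fun f => X p (fun q => Y q f))
    + (dphi_mx e theta nabla X Y p *m frame_mx p
       + phi_mx e theta nabla p (Y p) *m dh_mx p (X p)).
Proof.
move=> Wp W'p lX lY; apply/matrixP => i j.
have tX := local_tangent lX.
have sh a b : smooth_at p (h a b) by apply: frame_smooth.
have sphi a b := phi_smooth a b F LC Wp lY.
have sphi' a b := phi_smooth a b F' LC' W'p lY.
have sYh := local_vfield_smooth lY (sh i j).
have near_eq : \forall q \near p,
    \sum_s h i s q * phi e' theta' nabla' s j q (Y q)
    = Y q (h i j) + \sum_s phi e theta nabla i s q (Y q) * h s j q.
  apply: filterS2 (near_overlap Wp W'p) (local_vfield_near lY).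
  move=> q [Wq W'q] lYq.
  have /matrixP/(_ i j) := phi_change Wq W'q lYq.
  rewrite !mxE => E; transitivity (Y q (h i j) + \sum_s
      phi_mx e theta nabla q (Y q) i s * frame_mx q s j).
    by rewrite -E; apply: eq_bigr => s _; rewrite !mxE.
  by congr (_ + _); apply: eq_bigr => s _; rewrite !mxE.
have := eq_tangent tX near_eq.
rewrite (tangentD tX sYh) => [|]; last first.
  by apply: smooth_at_sum => s; apply: smooth_atM.
rewrite !(tangent_sum tX) => [|s|s]; try exact: smooth_atM.
move=> E; rewrite !mxE -!big_split /=.
transitivity (\sum_s X p (fun q => h i s q * phi e' theta' nabla' s j q (Y q))).
  apply: eq_bigr => s _; rewrite !mxE.
  by rewrite (tangent_leibniz tX (sh i s) (sphi' s j)).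
rewrite E; congr (_ + _); apply: eq_bigr => s _; rewrite !mxE.
by rewrite (tangent_leibniz tX (sphi i s) (sh s j)).
Qed.

(** In gmx' Jmix' = Jlow' both [gmx'] and [Jlow'] start with H^T; cancelling it and then [gmx]
    leaves the law of an endomorphism. *)
Lemma Jmix_change a p : W p -> W' p ->
  frame_mx p *m Jmix omega J e' a p
  = Jmix omega J e a p *m frame_mx p.
Proof.
move=> Wp W'p; have uH := frame_mx_unit Wp W'p.
have := mulKVmx (gmx_unit F' W'p) (Jlow omega J e' a p).
rewrite -/(Jmix omega J e' a p) (Jlow_change a Wp W'p).
rewrite (gmx_change Wp W'p) -!mulmxA.
move=> /(congr1 (mulmx (invmx (frame_mx p)^T))).
rewrite !mulKmx ?unitmx_tr // => E.
by rewrite -E mulKmx // (gmx_unit F).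
Qed.

Lemma curvature_change p X Y : W p -> W' p -> local_vfield p X ->
  local_vfield p Y ->
  frame_mx p
    *m \matrix_(i, j) curvature_form omega J e' theta' nabla' i j X Y p
  = (\matrix_(i, j) curvature_form omega J e theta nabla i j X Y p)
    *m frame_mx p.
Proof.
move=> Wp W'p lX lY; have lB := local_bracket lX lY.
rewrite !curvature_mxE -scalemxAl -scalemxAr; congr (_ *: _).
have pX := phi_change Wp W'p lX.
have pY := phi_change Wp W'p lY.
have pB := phi_change Wp W'p lB.
(* The second derivatives of H produced by the two uses of [dphi_change] cancel against this bracket
   term. *)
have bE : dh_mx p (bracket X Y p) = dh_mx p (fun f => X p (fun q => Y q f))
    - dh_mx p (fun f => Y p (fun q => X q f)).
  apply/matrixP => i j; rewrite !mxE bracketE //.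
  exact: frame_smooth.
rewrite -/(dh_mx p _) bE in pB.
rewrite mulmxBr mulmxDr mulmxBl mulmxDl.
rewrite (gauge_covariance pX pY pB (dphi_change Wp W'p lX lY)
  (dphi_change Wp W'p lY lX)).
rewrite !(theta_col_change Wp W'p (local_tangent lX)).
rewrite !(theta_col_change Wp W'p (local_tangent lY)).
congr (_ + _ - _).
  rewrite mulmx_sumr mulmx_suml; apply: eq_bigr => a _.
  rewrite mulmxBr mulmxBl; congr (_ - _);
  exact: outer_change (Jmix_change a Wp W'p) (Jlow_change a Wp W'p).
rewrite mulmxBr mulmxBl (gmx_change Wp W'p).
by congr (_ - _); rewrite !trmx_mul trmxK !mulmxA.
Qed.

(** The numbers [h a k p] and [h b l p] are the old coordinates of the vectors [e' k] and [e' l] on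
    which both curvature forms are evaluated. The upper index of [T'] keeps its factor H on the
    left, so no inverse appears. *)
Lemma frame_tensor_change (T T' : tensor M) i j k l p :
  curvature omega J e theta nabla W T ->
  curvature omega J e' theta' nabla' W' T' -> W p -> W' p ->
  \sum_s h i s p * T' s j k l p
  = \sum_s \sum_a \sum_b T i s a b p * (h s j p * h a k p * h b l p).
Proof.
move=> [sk TC] [sk' TC'] Wp W'p.
have dk := frame_local F' k W'p; have dl := frame_local F' l W'p.
have /matrixP/(_ i j) := curvature_change Wp W'p
  (local_sectionD_vfield dk) (local_sectionD_vfield dl).
rewrite !mxE => E.
transitivity (2 * \sum_s frame_mx p i s * (\matrix_(i, j)
   curvature_form omega J e' theta' nabla' i j (e' k) (e' l) p) s j).
  rewrite mulr_sumr; apply: eq_bigr => s _.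
  by rewrite (frame_components F' _ _ sk' (TC' s j) W'p) !mxE mulrCA.
rewrite E mulr_sumr; apply: eq_bigr => s _.
rewrite !mxE (tensor_components sk (TC i s) Wp dk dl).
rewrite mulrA mulrA mulfV ?mul1r ?pnatr_eq0 // mulr_suml; apply: eq_bigr => a _.
by rewrite mulr_suml; apply: eq_bigr => b _; rewrite /h; ring.
Qed.

Lemma tensor_eval_change (T T' : tensor M) p x y z :
  curvature omega J e theta nabla W T ->
  curvature omega J e' theta' nabla' W' T' -> W p -> W' p ->
  tangent p x -> tangent p y -> tangent p z ->
  tensor_eval e' theta' T' p x y z = tensor_eval e theta T p x y z.
Proof.
move=> cT cT' Wp W'p tx ty tz; apply: funext => f; rewrite /tensor_eval.
pose w (t : 'I_(4 * n) * 'I_(4 * n) * 'I_(4 * n)) :=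
  theta' t.1.1 p x * theta' t.1.2 p y * theta' t.2 p z.
have thE i v : tangent p v -> theta i p v = \sum_j h i j p * theta' j p v.
  move=> tv; have /matrixP/(_ i 0) := theta_col_change Wp W'p tv.
  by rewrite !mxE => ->; apply: eq_bigr => j _; rewrite !mxE.
(* Intermediate form: the output is already expanded in [e], the arguments are still in [theta'], so
   that the inner sum is the left side of [frame_tensor_change]. *)
transitivity (\sum_s \sum_t (\sum_i h s i p * T' i t.1.1 t.1.2 t.2 p) * w t
   * e s p f).
  under [RHS]eq_bigr do under eq_bigr do rewrite !mulr_suml.
  under [RHS]eq_bigr do rewrite exchange_big.
  rewrite [RHS]exchange_big; apply: eq_bigr => i _; rewrite sum3E /=.
  rewrite [RHS]exchange_big; apply: eq_bigr => t _.
  rewrite {1}(frame_change i Wp W'p) mulr_sumr; apply: eq_bigr => s _.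
  by rewrite /w /h; ring.
apply: eq_bigr => s _; rewrite sum3E /=.
under eq_bigr do rewrite (frame_tensor_change _ _ _ _ cT cT' Wp W'p) sum3E
  !mulr_suml.
rewrite exchange_big; apply: eq_bigr => u _ /=.
rewrite !thE // -(mulrA (T _ _ _ _ _)) -(mulrA (T _ _ _ _ _)).
rewrite -sum3M mulr_sumr mulr_suml; apply: eq_bigr => t _.
by rewrite /w; ring.
Qed.

End FrameChange.

(** Components are comparable only in a common frame, so the second half compares the multilinear
    maps defined by two frames. Both frames are adapted to [omega s]; [omega t] enters through
    [lam]. *)
Theorem proposition8p1 (R : realType) (n : nat) (hn : (0 < n)%N)
    (M : manifold R (4 * n + 3)) :
  (forall (U : set M) (omega omega' : 'I_3 -> form1 M)
      (J : 'I_3 -> M -> vec M -> vec M) (lam : M -> quat R),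
    qCR omega J U ->
    conformal_change U lam omega omega' ->
    forall (W : set M) (e : 'I_(4 * n) -> field M)
      (theta : 'I_(4 * n) -> form1 M) (nabla : connection M)
      (T T' : tensor M),
    W `<=` U ->
    adapted_frame omega J e theta W ->
    Levi_Civita W (gtilde omega J e theta) nabla ->
    curvature omega J e theta nabla W T ->
    curvature' omega J e theta nabla lam W T' ->
    forall i j k l p, W p -> T' i j k l p = T i j k l p)
  /\
  (forall (I : Type) (U : I -> set M) (omega : I -> 'I_3 -> form1 M)
      (J : I -> 'I_3 -> M -> vec M -> vec M),
    pseudo_conformal_qCR U omega J ->
    forall (s t : I) (lam : M -> quat R),
    conformal_change (U s `&` U t) lam (omega s) (omega t) ->
    forall (W W' : set M) (e e' : 'I_(4 * n) -> field M)
      (theta theta' : 'I_(4 * n) -> form1 M) (nabla nabla' : connection M)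
      (T T' : tensor M),
    W `<=` U s -> W' `<=` U s `&` U t ->
    adapted_frame (omega s) (J s) e theta W ->
    adapted_frame (omega s) (J s) e' theta' W' ->
    Levi_Civita W (gtilde (omega s) (J s) e theta) nabla ->
    Levi_Civita W' (gtilde (omega s) (J s) e' theta') nabla' ->
    curvature (omega s) (J s) e theta nabla W T ->
    curvature' (omega s) (J s) e' theta' nabla' lam W' T' ->
    forall p x y z, W p -> W' p ->
      distD (omega s) p x -> distD (omega s) p y -> distD (omega s) p z ->
      tensor_eval e' theta' T' p x y z = tensor_eval e theta T p x y z).
Proof.
split.
  move=> U omega omega' J lam H ch W e theta nabla T T' WU F LC cT cT'.
  move=> i j k l p Wp.
  exact (curvature'_eq F i j k l (change_neq0 ch (WU p Wp)) Wp cT cT').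
move=> I U omega J pc s t lam ch W W' e e' theta theta' nabla nabla' T T'.
move=> WU W'U F F' LC LC' cT [sk' TC'] p x y z Wp W'p dx dy dz.
have H := pc_local pc s.
have cT1 : curvature (omega s) (J s) e' theta' nabla' W' T'.
  (* The two curvature forms agree at every point of [W'], where [lam] does not vanish, so the same
     [eta] witnesses the congruence without [lam]. *)
  split=> // i j; have [eta [se E]] := TC' i j; exists eta.
  split=> // q X Y W'q lX lY.
  by rewrite -E // curvature_form'E //; apply: (change_neq0 ch); apply: W'U.
exact (tensor_eval_change H F F' WU LC LC' cT cT1 Wp W'p dx.1 dy.1 dz.1).
Qed.
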